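(* Let $n$ be even and let $L$ be the operator in $L^2(0,1)$ generated by $l(y)=D^ny+\sum_{k=0}^{n-2}p_k(x)D^ky$, $p_k\in L(0,1)$, and normalized boundary conditions $U_j(y)=0$, $j=0,\dots,n-1$. If $L$ is dissipative, then $L$ is Birkhoff-regular, i.e. $\Theta(S_0)\ne0$ and $\Theta(S_1)\ne0$.
   Context: **Operator.** $D=-i\,d/dx$, $p_k\in L(0,1)$ are (complex-valued) summable coefficients. The $n$ linearly independent boundary conditions are normalized: $U_j(y)\equiv b_j^0D^jy(0)+b_j^1D^jy(1)+\dots=0$, $j=0,\dots,n-1$, where the ellipsis stands for terms of order lower than $j$ at $0$ and at $1$; $b_j^0,b_j^1$ are column vectors of length $r_j$, $0\le r_j\le2$ ($r_j=0$ means no conditions of order $j$), $\sum_{j=0}^{n-1}r_j=n$, $\operatorname{rank}(b_j^0\ b_j^1)=r_j$, and if $r_j=2$ then $(b_j^0\ b_j^1)$ is the $2\times2$ identity matrix. $L$ acts as $Ly=l(y)$ on functions $y$ with $y,\dots,D^{n-1}y$ absolutely continuous, $l(y)\in L^2(0,1)$ and $U_j(y)=0$ for all $j$. $L$ is dissipative if $\operatorname{Im}(Ly,y)\ge0$ for all $y$ in its domain. **Regularity determinants.** Let $\varepsilon_k=\exp(2\pi ik/n)$ and $B_k^i=(b_j^i\varepsilon_k^j)_{j=0}^{n-1}\in\mathbb{C}^n$ (blocks stacked into one column), $i=0,1$. Let $S_\nu=\{\pi\nu/n\le\arg\varrho<\pi(\nu+1)/n\}$, $\nu=0,1$. For $n=2q$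 put $p=q$ for both $\nu=0,1$; then $\Theta(S_\nu)=\det\,[B_0^0,\dots,B_{p-1}^0,B_p^1,\dots,B_{n-1}^1]$. *)

(* Defs.v *)
From mathcomp Require Import all_boot all_order all_algebra.
From mathcomp Require Import all_classical all_reals all_analysis.
From mathcomp Require Import complex.
Set Implicit Arguments.
Unset Strict Implicit.
Unset Printing Implicit Defensive.

Import Order.TTheory GRing.Theory Num.Theory.
Import numFieldNormedType.Exports.
Import ComplexField.

Local Open Scope classical_set_scope.
Local Open Scope complex_scope.
Local Open Scope ring_scope.

Section CalculusOnUnitInterval.
Context {R : realType}.
Local Notation C := R[i].
Local Notation mu := (@lebesgue_measure R).
Local Notation I01 := (`]0, 1[%classic : set R).
Implicit Types (f : R -> R) (y : R -> C).

(* The limit is taken along t <> x in [0, 1]: it is one-sided at 0 and 1, so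
   nothing depends on how functions are extended outside [0, 1]. *)
Definition diff_quot f (x t : R) : R := (f t - f x) / (t - x).

Definition derivable01 f (x : R) : Prop :=
  cvg (diff_quot f x t @[t --> within `[0, 1] x^']).

Definition derive01 f (x : R) : R :=
  lim (diff_quot f x t @[t --> within `[0, 1] x^']).

Definition re y : R -> R := fun x => complex.Re (y x).
Definition im y : R -> R := fun x => complex.Im (y x).

(* D = - i d/dx; the value of [Dop y x] is arbitrary when y has no derivative
   at x. *)
Definition Dop y : R -> C :=
  fun x => - 'i%C * (derive01 (re y) x +i* derive01 (im y) x).

Definition abs_cont01 y : Prop :=
  forall e : R, 0 < e -> exists2 d : R, 0 < d &
    forall (m : nat) (a b : 'I_m -> R),
      (forall i, [/\ 0 <= a i, a i < b i & b i <= 1]) ->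
      (forall i j, i != j -> b i <= a j \/ b j <= a i) ->
      \sum_(i < m) (b i - a i) < d ->
      \sum_(i < m) Normc.normc (y (b i) - y (a i)) < e.

Definition summable01 y : Prop :=
  mu.-integrable I01 (EFin \o re y) /\
  mu.-integrable I01 (EFin \o im y).

Definition L2_01 y : Prop :=
  [/\ measurable_fun I01 (re y), measurable_fun I01 (im y) &
      (\int[mu]_(x in I01)
         (Normc.normc (y x) ^+ 2)%:E < +oo)%E].

Definition integral01 y : C :=
  (\int[mu]_(x in I01) re y x) +i*
  (\int[mu]_(x in I01) im y x).

Definition inner01 (u v : R -> C) : C := integral01 (fun x => u x * (v x)^*%C).

End CalculusOnUnitInterval.

(* Boundary forms of an operator of order n, grouped by order j < n.  The
   endpoints 0 and 1 are encoded by [false] and [true]; the columns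
   [bc_lead bc e j] are b_j^e, and [bc_low bc e j s], s < j, are the coefficients
   of the lower-order terms. *)
Record bconds (K : fieldType) (n : nat) := BConds {
  bc_num : 'I_n -> nat;
  bc_lead : bool -> forall j : 'I_n, 'cV[K]_(bc_num j);
  bc_low : bool -> forall j : 'I_n, 'I_j -> 'cV[K]_(bc_num j);
  bc_total : (\sum_(j < n) bc_num j = n)%N
}.

(* Since the leading blocks have full row rank, normalized forms are
   automatically linearly independent. *)
Definition normalized (K : fieldType) (n : nat) (bc : bconds K n) : Prop :=
  forall j : 'I_n,
    let b01 := row_mx (bc_lead bc false j) (bc_lead bc true j) in
    [/\ (bc_num bc j <= 2)%N,
        \rank b01 = bc_num bc j &
        bc_num bc j = 2%N ->
          forall (a : 'I_(bc_num bc j)) (c : 'I_(1 + 1)),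
            b01 a c = (a == c :> nat)%:R].

Section DifferentialOperator.
Context {R : realType}.
Local Notation C := R[i].
Variables (n : nat) (p : 'I_n.-1 -> R -> C) (bc : bconds C n).

Definition lexpr (y : R -> C) : R -> C :=
  fun x => iter n Dop y x + \sum_(k < n.-1) p k x * iter k Dop y x.

Definition bform (j : 'I_n) (y : R -> C) : 'cV[C]_(bc_num bc j) :=
  \sum_(e : bool)
    (iter j Dop y e%:R *: bc_lead bc e j +
     \sum_(s < j) iter s Dop y e%:R *: bc_low bc e s).

(* D^n y exists only almost everywhere, as the derivative of the absolutely
   continuous function D^(n-1) y. *)
Record in_domain (y : R -> C) : Prop := InDomain {
  dom_derivable : forall k x, (k.+1 < n)%N -> 0 <= x <= 1 ->
    derivable01 (re (iter k Dop y)) x /\ derivable01 (im (iter k Dop y)) x;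
  dom_abs_cont : forall k, (k < n)%N -> abs_cont01 (iter k Dop y);
  dom_L2 : L2_01 (lexpr y);
  dom_bform : forall j, bform j y = 0
}.

Definition dissipative : Prop :=
  forall y, in_domain y -> 0 <= complex.Im (inner01 (lexpr y) y).

(* exp (2 pi i k / n) *)
Definition eps (k : nat) : C :=
  let t : R := 2 * pi * k%:R / n%:R in cos t +i* sin t.

Definition Bcol (e : bool) (k : nat) : 'cV[C]_(\sum_(j < n) bc_num bc j) :=
  \mxcol_(j < n) (eps k ^+ j *: bc_lead bc e j).

(* The number p of columns taken at the endpoint 0, for the sector S_nu; this
   value is the one for even n, where it is the same for both sectors. *)
Definition sector_p (nu : 'I_2) : nat := n./2.

Definition Theta (nu : 'I_2) : C :=
  \det (castmx (bc_total bc, erefl n)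
    (\matrix_(a < \sum_(j < n) bc_num bc j, k < n)
       Bcol (sector_p nu <= k)%N k a 0)).

Definition birkhoff_regular : Prop := Theta ord0 != 0 /\ Theta ord_max != 0.

End DifferentialOperator.

(* Main.v *)
Require Import Defs.
From mathcomp Require Import all_boot all_order all_algebra.
From mathcomp Require Import all_classical all_reals all_analysis.
From mathcomp Require Import complex measurable_realfun.
From mathcomp Require Import ring lra zify.
Import Order.TTheory GRing.Theory Num.Theory.
Import numFieldNormedType.Exports.
Import ComplexField.
Set Implicit Arguments.
Unset Strict Implicit.
Unset Printing Implicit Defensive.
Local Open Scope classical_set_scope.
Local Open Scope ring_scope.

(** Dissipativity is tested on functions that live in layers of width [c] at the
    two end points, and [c] is sent to zero.

    In such a layer a derivative of order [k] has size [c ^ (- k)]. So the leading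
    term dominates in [l(y)], the terms of order [j] dominate in [U_j(y) = 0], and
    Green's formula for [D ^ n] turns [Im (l(y), y)] into boundary terms. In the
    limit one finds [Q(U) - Q(V) >= 0] for all Cauchy data [U] at 0 and [V] at 1
    with [b_j^0 U_j + b_j^1 V_j = 0] for all [j], where [Q(U)] is the sum of the
    [U_(n-1-k) conj(U_k)] ([dissipative_cauchy_form]).

    If [Theta] vanishes, let [a_k] be the coefficients of a linear relation between
    its columns. With [z_k = omega eps_k] and [omega = exp (3 pi i / 2n)], the data
    [U_j = sum_(k < n/2) a_k z_k ^ j] and [V_j = sum_(k >= n/2) a_k z_k ^ j] satisfy
    the leading conditions, since these are homogeneous in each order and do not
    see [omega]. They belong to solutions of [D ^ n y = - i y] that decay away from
    the end point, so their energy has to be negative. In algebraic terms,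
    [Q(U) = - 2 sum_(k,l) a_k conj(a_l) i / (z_k - conj z_l)]; this Cauchy matrix is
    positive definite because the [z_k] lie in the upper half-plane
    ([cauchy_gram_definite]), and in the same way [Q(V)] is positive. So
    [Q(U) - Q(V) < 0] unless all [a_k] vanish ([dissipative_Theta]).

    The test functions need [l(y)] to be square integrable, whereas the coefficients
    are only summable, so smooth functions are not available. Given a polynomial
    [P] that vanishes to order [n] at the inner end of the scaled layer, [y] is the
    solution of [l(y) = f] with zero Cauchy data at the inner end, where [f] is
    [D ^ n] of the profile [P((x - e) / c)] inside the layer and zero outside. The
    Volterra equation for [y] has small norm, and as [l] has no term of order
    [n - 1], [y] differs from the profile by a relative error of order [c]
    ([layer_solution]). Moreover [(l(y), y) = (f, y)], where the coefficients do not
    appear. The boundary conditions are then met exactly by combining finitely many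
    layers with coefficients that depend on [c] ([correct_kernel]).

    Finally, [D ^ n y] exists almost everywhere only, and membership in the domain
    requires Borel measurability of its pointwise version
    ([derive01_measurable]). *)

(** * Primitives of integrable functions *)

Section Primitive.
Context {R : realType}.
Local Notation mu := (@lebesgue_measure R).
Implicit Types (g h : R -> R) (x a : R).

Definition L1 g := mu.-integrable setT (EFin \o g).

Definition prim g x : R := \int[mu]_(t in `]-oo, x]) g t.

Definition intfrom a g x : R := prim g x - prim g a.

Definition norm1 g : R := \int[mu]_t `|g t|.

Lemma L1S (A : set (measurableTypeR R)) g : measurable A -> L1 g -> mu.-integrable A (EFin \o g).
Proof. by move=> mA; apply: integrableS. Qed.

Lemma L1_measurable g : L1 g -> measurable_fun setT g.
Proof. by move=> /integrableP[/measurable_EFinP]. Qed.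

Lemma L1D g h : L1 g -> L1 h -> L1 (fun t => g t + h t).
Proof. by move=> ig ih; have := integrableD measurableT ig ih. Qed.

Lemma L1Z r g : L1 g -> L1 (fun t => r * g t).
Proof. by move=> ig; have := integrableZl measurableT r ig. Qed.

Lemma L1N g : L1 g -> L1 (fun t => - g t).
Proof. by move=> /(L1Z (-1)); under eq_fun do rewrite mulN1r. Qed.

Lemma L10 : L1 (fun=> 0).
Proof. exact: integrable0. Qed.

Lemma L1_sum (I : Type) (s : seq I) (F : I -> R -> R) :
  (forall i, L1 (F i)) -> L1 (fun t => \sum_(i <- s) F i t).
Proof.
move=> iF; elim: s => [|i s IH].
  by under eq_fun do rewrite big_nil; exact: L10.
by under eq_fun do rewrite big_cons; exact: L1D.
Qed.

Lemma L1_abs g : L1 g -> L1 (fun t => `|g t|).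
Proof. by move/integrable_abse. Qed.

Lemma L1M g h (M : R) : L1 g -> measurable_fun setT h ->
  (forall t, `|h t| <= M) -> L1 (fun t => g t * h t).
Proof.
move=> ig mh hM.
apply: (le_integrable measurableT _ _ (L1Z M (L1_abs ig))) => /=.
  by apply/measurable_EFinP/measurable_funM => //; exact: L1_measurable.
move=> t _; rewrite lee_fin normrM [leRHS]ger0_norm.
  by rewrite mulrC ler_wpM2r.
by rewrite mulr_ge0// (le_trans _ (hM t)).
Qed.

Lemma norm1_ge0 g : 0 <= norm1 g.
Proof. by apply: Rintegral_ge0. Qed.

Lemma norm1D g h : L1 g -> L1 h -> norm1 (fun t => g t + h t) <= norm1 g + norm1 h.
Proof.
move=> ig ih; rewrite /norm1 -RintegralD//; try exact: L1_abs.
by apply: le_Rintegral => // [||t _]; [exact/L1_abs/L1D|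
  exact: (L1D (L1_abs ig) (L1_abs ih))|exact: ler_normD].
Qed.

Lemma norm1_0 : norm1 (fun=> 0) = 0.
Proof. by rewrite /norm1; under eq_Rintegral do rewrite normr0; rewrite Rintegral_cst// mul0r. Qed.

Lemma norm1_sum (I : Type) (s : seq I) (F : I -> R -> R) :
  (forall i, L1 (F i)) ->
  norm1 (fun t => \sum_(i <- s) F i t) <= \sum_(i <- s) norm1 (F i).
Proof.
move=> iF; elim: s => [|i s IH].
  by under eq_fun do rewrite big_nil; rewrite big_nil norm1_0.
under eq_fun do rewrite big_cons.
by rewrite big_cons (le_trans (norm1D _ _))// ?lerD2l//; exact: L1_sum.
Qed.

Lemma norm1M g h (M : R) : L1 g -> measurable_fun setT h -> 
  (forall t, `|h t| <= M) -> norm1 (fun t => g t * h t) <= norm1 g * M.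
Proof.
move=> ig mh hM.
have M0 : 0 <= M by rewrite (le_trans _ (hM 0)).
rewrite /norm1 -RintegralZr//; last exact: L1_abs.
apply: le_Rintegral => //.
- by apply/L1_abs/L1M/hM.
- have := L1Z M (L1_abs ig); apply: eq_integrable => // t _ /=.
  by rewrite mulrC.
- by move=> t _; rewrite normrM ler_wpM2l.
Qed.

Lemma prim_itv g x y : L1 g -> x <= y ->
  prim g y - prim g x = \int[mu]_(t in `]x, y]) g t.
Proof. by move=> ig xy; rewrite /prim Rintegral_itvB//; exact: L1S. Qed.

Lemma intfromD a g h x : L1 g -> L1 h ->
  intfrom a (fun t => g t + h t) x = intfrom a g x + intfrom a h x.
Proof.
move=> ig ih; rewrite /intfrom /prim !RintegralD//; try exact: L1S.
by rewrite opprD addrACA.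
Qed.

Lemma intfromZ a r g x : L1 g -> intfrom a (fun t => r * g t) x = r * intfrom a g x.
Proof. by move=> ig; rewrite /intfrom /prim !RintegralZl ?mulrBr//; exact: L1S. Qed.

Lemma intfromN a g x : L1 g -> intfrom a (fun t => - g t) x = - intfrom a g x.
Proof. by move=> ig; under eq_fun do rewrite -mulN1r; rewrite intfromZ// mulN1r. Qed.

Lemma intfrom0 a x : intfrom a (fun=> 0) x = 0.
Proof. by have := intfromZ a 0 x L10; rewrite mul0r mul0r. Qed.

Lemma intfrom_le_norm1_itv a g x : L1 g ->
  `|intfrom a g x| <= \int[mu]_(t in `]Num.min a x, Num.max a x[) `|g t|.
Proof.
move=> ig; wlog ax : a x / a <= x => [H|].
  case: (leP a x) => [ax|/ltW xa].
    by move: (H a x ax); rewrite min_l// max_r.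
  move: (H x a xa); rewrite /intfrom distrC.
  by rewrite min_l// max_r.
rewrite /intfrom prim_itv// min_l// max_r// -Rintegral_itv_bndo_bndc; last exact: L1S.
by apply: le_normr_Rintegral => //; exact: L1S.
Qed.

Lemma intfrom_le_norm1 a g x : L1 g -> `|intfrom a g x| <= norm1 g.
Proof.
move=> ig; apply: (le_trans (intfrom_le_norm1_itv _ _ ig)).
rewrite /norm1 /Rintegral fine_le//.
- by apply: integrable_fin_num => //; apply: L1S => //; exact: L1_abs.
- by apply: integrable_fin_num => //; exact: L1_abs.
apply: ge0_subset_integral => //.
by have /measurable_EFinP := L1_measurable (L1_abs ig).
Qed.

(** Restricting the comparison to the open interval makes it irrelevant whether
    cut-offs include the end points. *)
Lemma eq_intfrom a x g h : L1 g -> L1 h ->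
  {in `]Num.min a x, Num.max a x[, g =1 h} -> intfrom a g x = intfrom a h x.
Proof.
move=> ig ih gh; apply/eqP; rewrite -subr_eq0 -intfromN// -intfromD//; last exact: L1N.
rewrite -normr_le0.
apply: (le_trans (intfrom_le_norm1_itv _ _ _)); first exact/L1D/L1N.
rewrite (@eq_Rintegral _ _ _ _ _ (fun=> 0)) ?Rintegral_cst ?mul0r//.
by move=> t; rewrite inE/= => /gh ->; rewrite subrr normr0.
Qed.

(** Absolute continuity of the integral, applied to the union of the
    intervals. *)
Lemma prim_abs_cont g (e : R) : L1 g -> 0 < e -> exists2 d : R, 0 < d &
  forall (m : nat) (a b : 'I_m -> R), (forall i, a i < b i) ->
    (forall i j, i != j -> b i <= a j \/ b j <= a i) ->
    \sum_(i < m) (b i - a i) < d ->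
    \sum_(i < m) `|prim g (b i) - prim g (a i)| < e.
Proof.
move=> ig e0; have [d [d0 Hd]] := integral_normr_continuous ig e0.
exists d => // m a b ab disj sd.
pose A i : set (measurableTypeR R) := `]a i, b i]%classic.
have mA i : measurable (A i) by exact: measurable_itv.
have muA i : mu (A i) = (b i - a i)%:E.
  by rewrite /A lebesgue_measure_itv/= lte_fin ab.
have tA : trivIset setT A.
  apply/trivIsetP => i j _ _ ij; rewrite -subset0 => t.
  rewrite /A /= !in_itv/= => -[/andP[ai bi] /andP[aj bj]].
  case: (disj _ _ ij) => h.
    by move: (lt_le_trans aj bi); rewrite ltNge h.
  by move: (lt_le_trans ai bj); rewrite ltNge h.
have mUA : measurable (\big[setU/set0]_(i < m) A i) by apply: bigsetU_measurable.
apply: (le_lt_trans _ (Hd _ mUA _)); last first.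
  rewrite measure_bigsetU_ord//.
  by rewrite (eq_bigr _ (fun i _ => muA i)) sumEFin lte_fin.
rewrite -lee_fin fineK; last first.
  by apply: integrable_fin_num => //; apply: L1S => //; exact: L1_abs.
rewrite ge0_integral_bigsetU//=; [|exact: index_enum_uniq|exact: sub_trivIset tA|]; last first.
  apply: (measurable_funS measurableT) => //.
  by have /measurable_EFinP := L1_measurable (L1_abs ig).
rewrite -sumEFin; apply: lee_sum => i _.
rewrite prim_itv//; last exact: ltW.
rewrite -[leRHS]fineK; last first.
  apply: integrable_fin_num; first exact: mA.
  exact: (L1S (mA i) (L1_abs ig)).
by rewrite lee_fin; apply: (le_normr_Rintegral (mA i) (L1S (mA i) ig)).
Qed.

Lemma prim_continuous g : L1 g -> continuous (prim g).
Proof.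
move=> ig x; apply/cvgrPdist_lt => /= e e0.
have [d d0 Hd] := prim_abs_cont ig e0.
exists d => // t /= xtd.
have H u v : u < v -> v - u < d -> `|prim g v - prim g u| < e.
  move=> uv vud; have := Hd 1%N (fun=> u) (fun=> v).
  rewrite !big_ord1; apply => //.
  by move=> i j; rewrite !ord1 eqxx.
have [xt|tx|->] := ltgtP x t.
- by rewrite distrC; apply: H => //; rewrite distrC gtr0_norm ?subr_gt0 in xtd.
- by apply: H => //; rewrite gtr0_norm ?subr_gt0 in xtd.
- by rewrite subrr normr0.
Qed.

Lemma intfrom_measurable a g : L1 g -> measurable_fun setT (intfrom a g).
Proof.
move=> ig; apply: measurable_funB; last exact: measurable_cst.
by apply: continuous_measurable_fun; exact: prim_continuous.
Qed.

Lemma prim_derivable_ae g : L1 g ->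
  {ae mu, forall x, derivable (prim g) x 1 /\ derive1 (prim g) x = g x}.
Proof.
move=> ig; apply: FTC1Ny => [y|]; first exact: L1S.
by apply: open_integrable_locally => //; exact: openT.
Qed.

Lemma prim_derivable g x : L1 g -> {for x, continuous g} ->
  derivable (prim g) x 1 /\ derive1 (prim g) x = g x.
Proof.
move=> ig cg; apply: (@continuous_FTC1 _ _ _ _ (x + 1)) => //.
- by rewrite ltrDl.
- exact: L1S.
- by rewrite ltNyr.
Qed.

End Primitive.

(** * Linear Volterra equations with summable coefficients *)

Section Volterra.
Context {R : realType}.
Local Notation mu := (@lebesgue_measure R).

Lemma geometric_cauchy_cvg (u : nat -> R) (M : R) :
  (forall m, `|u m.+1 - u m| <= M / 2 ^+ m) -> cvgn u.
Proof.
move=> H.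
have : cvgn (series (fun m => u m.+1 - u m)).
  apply: normed_cvg.
  apply: (@series_le_cvg _ _ (geometric M (2^-1))) => //.
  - by move=> m /=.
  - move=> m; rewrite /= mulr_ge0 ?exprn_ge0 ?invr_ge0//.
    by have := H 0%N; rewrite expr0 divr1; exact: le_trans.
  - by move=> m /=; rewrite (le_trans (H m))// exprVn.
  - by apply: is_cvg_geometric_series; rewrite gtr0_norm ?invr_gt0// invf_lt1// ltr1n.
rewrite (_ : series _ = (fun m => u m - u 0%N)); last first.
  by apply/funext => m; rewrite /series/= telescope_sumr.
move=> /cvg_ex[l ul]; apply/cvg_ex; exists (l + u 0%N).
rewrite [X in X @ _ --> _](_ : u = (fun m => (u m - u 0%N) + u 0%N)); last first.
  by apply/funext => m; rewrite subrK.
by apply: cvgD; [exact: ul|exact: cvg_cst].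
Qed.

Lemma cvgn_sum (I : Type) (s : seq I) (F : I -> nat -> R) (l : I -> R) :
  (forall i, F i @ \oo --> l i) ->
  \sum_(i <- s) F i m @[m --> \oo] --> \sum_(i <- s) l i.
Proof.
move=> Fl; elim: s => [|i s IH].
  by rewrite big_nil; under eq_cvg do rewrite big_nil; exact: cvg_cst.
rewrite big_cons; under eq_cvg do rewrite big_cons.
by apply: cvgD; [exact: Fl|exact: IH].
Qed.

Lemma intfrom_dominated_cvg (a x : R) (u : nat -> R -> R) (f g : R -> R) :
  (forall m, measurable_fun setT (u m)) -> L1 g ->
  (forall m t, `|u m t| <= g t) -> (forall t, u ^~ t @ \oo --> f t) ->
  intfrom a (u m) x @[m --> \oo] --> intfrom a f x.
Proof.
move=> mu_ ig ug uf.
have mf : measurable_fun setT f by apply: (measurable_fun_cvg mu_) => t _; exact: uf.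
have iu m : L1 (u m).
  apply: (le_integrable measurableT _ _ ig) => /=.
    by apply/measurable_EFinP; exact: mu_.
  by move=> t _; rewrite lee_fin (le_trans (ug m t))// ler_norm.
have fg t : `|f t| <= g t.
  have uft : `|u m t| @[m --> \oo] --> `|f t| by apply: cvg_norm; exact: uf.
  by apply: (cvgr_to_le uft); exact: nearW.
have if_ : L1 f.
  apply: (le_integrable measurableT _ _ ig) => /=.
    by apply/measurable_EFinP; exact: mf.
  by move=> t _; rewrite lee_fin (le_trans (fg t))// ler_norm.
have H y : prim (u m) y @[m --> \oo] --> prim f y.
  rewrite /prim /Rintegral; apply: fine_cvg; rewrite fineK; last first.
    by apply: integrable_fin_num => //; exact: L1S.
  have [|||||_ _ ]:= @dominated_convergence _ _ _ mu `]-oo, y] (measurable_itv _)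
    (fun m t => (u m t)%:E) (EFin \o f) (EFin \o g).
  - by move=> m; apply/measurable_EFinP; apply: measurable_funS (mu_ m).
  - by apply/measurable_EFinP; apply: measurable_funS mf.
  - by apply: aeW => t _; apply: cvg_EFin; [exact: nearW|exact: uf].
  - exact: L1S.
  - by apply: aeW => t m _ /=; rewrite lee_fin.
  exact.
exact: cvgB.
Qed.

(** Picard iteration. The weights [W] make the integral operator a contraction by
    one half; the iterates are then dominated by an integrable function, so the
    limit may be taken under the integral sign. *)
Lemma volterra (I : finType) (A : I -> I -> R -> R) (b : I -> R -> R)
    (W : I -> R) (K a : R) :
  (forall i j, L1 (A i j)) -> (forall i, measurable_fun setT (b i)) ->
  (forall i, 0 <= W i) -> 0 <= K -> (forall i x, `|b i x| <= K * W i) ->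
  (forall i, \sum_j norm1 (A i j) * W j <= W i / 2) ->
  exists z : I -> R -> R, [/\ forall i, measurable_fun setT (z i),
    forall i x, `|z i x| <= 2 * K * W i &
    forall i x, z i x = b i x + intfrom a (fun t => \sum_j A i j t * z j t) x].
Proof.
move=> iA mb W0 K0 bK AW.
have iAz (z : I -> R -> R) M i j : (forall i, measurable_fun setT (z i)) ->
  (forall i x, `|z i x| <= M * W i) -> L1 (fun t => A i j t * z j t).
  by move=> mz zM; apply: L1M => //; exact: zM.
have iAzs (z : I -> R -> R) M i : (forall i, measurable_fun setT (z i)) ->
  (forall i x, `|z i x| <= M * W i) -> L1 (fun t => \sum_j A i j t * z j t).
  by move=> mz zM; apply: L1_sum => j; exact: (iAz _ M).
have bnd (z : I -> R -> R) M i x : (forall i, measurable_fun setT (z i)) -> 0 <= M ->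
  (forall i x, `|z i x| <= M * W i) ->
  `|intfrom a (fun t => \sum_j A i j t * z j t) x| <= M / 2 * W i.
  move=> mz M0 zM; apply: (le_trans (intfrom_le_norm1 _ _ (iAzs _ _ _ mz zM))).
  apply: (le_trans (norm1_sum _ (fun j => iAz _ M i j mz zM))).
  apply: (@le_trans _ _ (M * \sum_j norm1 (A i j) * W j)).
    rewrite mulr_sumr; apply: ler_sum => j _.
    rewrite mulrCA; apply: norm1M => //; exact: zM.
  by rewrite -mulrA ler_wpM2l// mulrC.
pose T (z : I -> R -> R) i x := b i x + intfrom a (fun t => \sum_j A i j t * z j t) x.
pose Z m := iter m T b.
have ZP m : (forall i, measurable_fun setT (Z m i)) /\
    (forall i x, `|Z m i x| <= 2 * K * W i).
  elim: m => [|m [mZ ZK]]; rewrite /Z/=.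
    by split=> // i x; rewrite (le_trans (bK i x))// ler_wpM2r// ler_peMl// ler1n.
  split=> i.
    apply: measurable_funD => //; apply: intfrom_measurable.
    exact: (iAzs _ (2 * K)).
  move=> x; rewrite /T (le_trans (ler_normD _ _))//.
  have := bnd _ (2 * K) i x mZ _ ZK; rewrite mulr_ge0// => /(_ isT).
  rewrite (_ : 2 * K / 2 = K); last by field.
  move=> h.
  by rewrite (le_trans (lerD (bK i x) h))// -mulrA mulr_natl mulr2n.
have dZ m i x : `|Z m.+1 i x - Z m i x| <= (K / 2 ^+ m) * W i.
  elim: m i x => [|m IH] i x.
    rewrite /Z/= {1}/T addrAC subrr add0r expr0 divr1.
    apply: (le_trans (bnd _ K i x mb K0 bK)).
    by rewrite ler_wpM2r// ler_piMr// invf_le1// ler1n.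
  have [m1 b1] := ZP m.+1; have [m0 b0] := ZP m.
  rewrite /Z 2!iterS -/(Z m) -[T (Z m)]/(Z m.+1) /T opprD addrACA subrr add0r.
  rewrite -intfromN; last exact: (iAzs _ (2 * K)).
  rewrite -intfromD; [|exact: (iAzs _ (2 * K))|apply: L1N; exact: (iAzs _ (2 * K))].
  under [X in intfrom a X]eq_fun => t.
    rewrite -sumrB; under eq_bigr do rewrite -mulrBr; over.
  have -> : K / 2 ^+ m.+1 = (K / 2 ^+ m) / 2 by rewrite exprSr invfM mulrA.
  apply: (bnd (fun i t => Z m.+1 i t - Z m i t)).
  - by move=> j; apply: measurable_funB.
  - by rewrite mulr_ge0// invr_ge0 exprn_ge0.
  - exact: IH.
have cZ i x : cvgn (fun m => Z m i x).
  apply: (@geometric_cauchy_cvg _ (K * W i)) => m.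
  by rewrite mulrAC.
pose z i x := limn (fun m => Z m i x).
have Zz i x : Z m i x @[m --> \oo] --> z i x by exact: cZ.
have mz i : measurable_fun setT (z i).
  by apply: (measurable_fun_cvg (fun m => (ZP m).1 i)) => t _; exact: Zz.
have zK i x : `|z i x| <= 2 * K * W i.
  have h : `|Z m i x| @[m --> \oo] --> `|z i x| by apply: cvg_norm; exact: Zz.
  by apply: (cvgr_to_le h); apply: nearW => m; exact: (ZP m).2.
exists z; split => // i x.
have h1 : Z m.+1 i x @[m --> \oo] --> z i x.
  by rewrite (cvg_shiftS (fun m => Z m i x)); exact: Zz.
apply: (cvg_unique _ h1) => //; rewrite /Z.
apply: cvgD; first exact: cvg_cst.
apply: (@intfrom_dominated_cvg _ _ _ _ (fun t => \sum_j `|A i j t| * (2 * K * W j))).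
- move=> m; apply: L1_measurable; apply: (iAzs _ (2 * K)); [exact: (ZP m).1|exact: (ZP m).2].
- apply: L1_sum => j; apply: L1M => //; first exact: L1_abs.
- move=> m t; apply: (le_trans (ler_norm_sum _ _ _)); apply: ler_sum => j _.
  by rewrite normrM ler_wpM2l//; exact: (ZP m).2.
- move=> t; 
  apply: (@cvgn_sum _ _ (fun j m => A i j t * Z m j t)) => j; apply: cvgM; [exact: cvg_cst|].
  exact: Zz.
Qed.

End Volterra.

(** * Complex-valued integrands *)

Section Taxicab.
Context {R : realType}.
Local Notation C := R[i].
Implicit Types z w : C.

Lemma ReM z w : complex.Re (z * w) =
  complex.Re z * complex.Re w - complex.Im z * complex.Im w.
Proof. by case: z w => [a b] [c d]. Qed.

Lemma ImM z w : complex.Im (z * w) =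
  complex.Re z * complex.Im w + complex.Im z * complex.Re w.
Proof. by case: z w => [a b] [c d]. Qed.

Lemma ReD z w : complex.Re (z + w) = complex.Re z + complex.Re w.
Proof. by case: z w => [a b] [c d]. Qed.

Lemma ImD z w : complex.Im (z + w) = complex.Im z + complex.Im w.
Proof. by case: z w => [a b] [c d]. Qed.

Lemma ReN z : complex.Re (- z) = - complex.Re z.
Proof. by case: z => [a b]. Qed.

Lemma ImN z : complex.Im (- z) = - complex.Im z.
Proof. by case: z => [a b]. Qed.

Lemma ReJ z : complex.Re (z^*)%C = complex.Re z.
Proof. by case: z => [a b]. Qed.

Lemma ImJ z : complex.Im (z^*)%C = - complex.Im z.
Proof. by case: z => [a b]. Qed.

Lemma Re_sum (I : Type) (s : seq I) (F : I -> C) :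
  complex.Re (\sum_(i <- s) F i) = \sum_(i <- s) complex.Re (F i).
Proof. by elim/big_rec2: _ => // i x y _ <-; rewrite ReD. Qed.

Lemma Im_sum (I : Type) (s : seq I) (F : I -> C) :
  complex.Im (\sum_(i <- s) F i) = \sum_(i <- s) complex.Im (F i).
Proof. by elim/big_rec2: _ => // i x y _ <-; rewrite ImD. Qed.

Lemma complexP z w : complex.Re z = complex.Re w ->
  complex.Im z = complex.Im w -> z = w.
Proof. by case: z w => [a b] [c d] /= -> ->. Qed.

(** The taxicab norm is used because it is submultiplicative and controls real
    and imaginary parts without any square root. *)
Definition nrm z : R := `|complex.Re z| + `|complex.Im z|.

Lemma nrm_ge0 z : 0 <= nrm z. Proof. exact: addr_ge0. Qed.

Lemma nrm0 : nrm 0 = 0. Proof. by rewrite /nrm /= normr0 addr0. Qed.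

Lemma nrm_Re z : `|complex.Re z| <= nrm z. Proof. by rewrite /nrm lerDl. Qed.

Lemma nrm_Im z : `|complex.Im z| <= nrm z. Proof. by rewrite /nrm lerDr. Qed.

Lemma nrmD z w : nrm (z + w) <= nrm z + nrm w.
Proof. by rewrite /nrm ReD ImD addrACA lerD// ler_normD. Qed.

Lemma nrmN z : nrm (- z) = nrm z.
Proof. by rewrite /nrm ReN ImN !normrN. Qed.

Lemma nrmM z w : nrm (z * w) <= nrm z * nrm w.
Proof.
rewrite /nrm ReM ImM (le_trans (lerD (ler_normB _ _) (ler_normD _ _)))// !normrM.
by rewrite le_eqVlt; apply/orP; left; apply/eqP; ring.
Qed.

Lemma nrmZ (r : R) z : nrm (r%:C%C * z) = `|r| * nrm z.
Proof.
by rewrite /nrm ReM ImM /= !mul0r subr0 addr0 !normrM mulrDr.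
Qed.

Lemma nrmJ z : nrm (z^*)%C = nrm z.
Proof. by rewrite /nrm ReJ ImJ normrN. Qed.

Lemma nrm_iM z : nrm ('i%C * z) = nrm z.
Proof.
by rewrite /nrm ReM ImM /= !mul0r !mul1r sub0r add0r normrN addrC.
Qed.

Lemma nrm_sum (I : Type) (s : seq I) (F : I -> C) :
  nrm (\sum_(i <- s) F i) <= \sum_(i <- s) nrm (F i).
Proof.
elim/big_rec2: _ => [|i x y _ h]; first by rewrite nrm0.
by rewrite (le_trans (nrmD _ _))// lerD2l.
Qed.

Lemma normc_le_nrm z : Normc.normc z <= nrm z.
Proof.
case: z => a b; rewrite /nrm /= -(ger0_norm (addr_ge0 (normr_ge0 a) (normr_ge0 b))).
rewrite -sqrtr_sqr ler_sqrt ?sqr_ge0// sqrrD !real_normK ?num_real//.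
by rewrite addrAC lerDl mulrn_wge0// mulr_ge0.
Qed.

End Taxicab.

Section ComplexPrimitive.
Context {R : realType}.
Local Notation C := R[i].
Local Notation mu := (@lebesgue_measure R).
Implicit Types (g h : R -> C) (x a : R).

Definition cL1 g := L1 (re g) /\ L1 (im g).

Definition cmeas g := measurable_fun setT (re g) /\ measurable_fun setT (im g).

Definition cintfrom a g x : C := (intfrom a (re g) x +i* intfrom a (im g) x)%C.

Definition cnorm1 g : R := norm1 (re g) + norm1 (im g).

Lemma cL1D g h : cL1 g -> cL1 h -> cL1 (fun t => g t + h t).
Proof.
move=> [rg ig] [rh ih]; split.
  by rewrite (_ : re _ = fun t => re g t + re h t); [exact: L1D|apply/funext => t; exact: ReD].
by rewrite (_ : im _ = fun t => im g t + im h t); [exact: L1D|apply/funext => t; exact: ImD].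
Qed.

Lemma cmeas_cst (c : C) : cmeas (fun=> c).
Proof. by split; exact: measurable_cst. Qed.

Lemma cmeasD g h : cmeas g -> cmeas h -> cmeas (fun t => g t + h t).
Proof.
move=> [rg ig] [rh ih]; split.
  rewrite (_ : re _ = fun t => re g t + re h t); first exact: measurable_funD.
  by apply/funext => t; exact: ReD.
rewrite (_ : im _ = fun t => im g t + im h t); first exact: measurable_funD.
by apply/funext => t; exact: ImD.
Qed.

Lemma cmeasM g h : cmeas g -> cmeas h -> cmeas (fun t => g t * h t).
Proof.
move=> [rg ig] [rh ih]; split.
  rewrite (_ : re _ = fun t => re g t * re h t - im g t * im h t).
    by apply: measurable_funB; exact: measurable_funM.
  by apply/funext => t; exact: ReM.
rewrite (_ : im _ = fun t => re g t * im h t + im g t * re h t).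
  by apply: measurable_funD; exact: measurable_funM.
by apply/funext => t; exact: ImM.
Qed.

Lemma cmeasN g : cmeas g -> cmeas (fun t => - g t).
Proof.
move=> mg; rewrite (_ : (fun t => _) = (fun t => (-1) * g t)).
  by apply: cmeasM => //; exact: cmeas_cst.
by apply/funext => t; rewrite mulN1r.
Qed.

Lemma cmeas_sum (I : Type) (s : seq I) (F : I -> R -> C) :
  (forall i, cmeas (F i)) -> cmeas (fun t => \sum_(i <- s) F i t).
Proof.
move=> mF; elim: s => [|i s IH].
  by under eq_fun do rewrite big_nil; exact: cmeas_cst.
by under eq_fun do rewrite big_cons; exact: cmeasD.
Qed.

Lemma cmeasJ g : cmeas g -> cmeas (fun t => (g t)^*%C).
Proof.
move=> [rg ig]; split.
  by rewrite (_ : re _ = re g)//; apply/funext => t; exact: ReJ.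
rewrite (_ : im _ = fun t => - im g t); last by apply/funext => t; exact: ImJ.
exact: measurable_funN.
Qed.

Lemma cL1_meas g : cL1 g -> cmeas g.
Proof. by move=> [rg ig]; split; exact: L1_measurable. Qed.

Lemma cL1M g h (M : R) : cL1 g -> cmeas h -> (forall t, nrm (h t) <= M) ->
  cL1 (fun t => g t * h t).
Proof.
move=> [rg ig] [rh ih] hM.
have hr t : `|re h t| <= M := le_trans (nrm_Re _) (hM t).
have hi t : `|im h t| <= M := le_trans (nrm_Im _) (hM t).
split.
  rewrite (_ : re _ = fun t => re g t * re h t + - (im g t * im h t)).
    apply: L1D; first exact: (L1M rg rh hr).
    by apply: L1N; exact: (L1M ig ih hi).
  by apply/funext => t; exact: ReM.
rewrite (_ : im _ = fun t => re g t * im h t + im g t * re h t).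
  by apply: L1D; [exact: (L1M rg ih hi)|exact: (L1M ig rh hr)].
by apply/funext => t; exact: ImM.
Qed.

Lemma cL1Z (c : C) g : cL1 g -> cL1 (fun t => c * g t).
Proof.
move=> ig; under eq_fun do rewrite mulrC.
by apply: (cL1M (M := nrm c)) => //; exact: cmeas_cst.
Qed.

Lemma cL10 : cL1 (fun=> 0).
Proof. by split; exact: L10. Qed.

Lemma cL1_sum (I : Type) (s : seq I) (F : I -> R -> C) :
  (forall i, cL1 (F i)) -> cL1 (fun t => \sum_(i <- s) F i t).
Proof.
move=> iF; elim: s => [|i s IH].
  by under eq_fun do rewrite big_nil; exact: cL10.
by under eq_fun do rewrite big_cons; exact: cL1D.
Qed.

Lemma cnorm1D g h : cL1 g -> cL1 h -> cnorm1 (fun t => g t + h t) <= cnorm1 g + cnorm1 h.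
Proof.
move=> [rg ig] [rh ih]; rewrite /cnorm1.
rewrite (_ : re _ = fun t => re g t + re h t); last by apply/funext => t; exact: ReD.
rewrite (_ : im (fun t => g t + h t) = fun t => im g t + im h t); last first.
  by apply/funext => t; exact: ImD.
by rewrite addrACA lerD//; exact: norm1D.
Qed.

Lemma cnorm1_0 : cnorm1 (fun=> 0) = 0.
Proof. by rewrite /cnorm1 /re /im /= norm1_0 addr0. Qed.

Lemma cnorm1_sum (I : Type) (s : seq I) (F : I -> R -> C) :
  (forall i, cL1 (F i)) ->
  cnorm1 (fun t => \sum_(i <- s) F i t) <= \sum_(i <- s) cnorm1 (F i).
Proof.
move=> iF; elim: s => [|i s IH].
  by under eq_fun do rewrite big_nil; rewrite big_nil cnorm1_0.
under eq_fun do rewrite big_cons.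
by rewrite big_cons (le_trans (cnorm1D _ _))// ?lerD2l//; exact: cL1_sum.
Qed.

Lemma cnorm1M g h (M : R) : cL1 g -> cmeas h -> (forall t, nrm (h t) <= M) ->
  cnorm1 (fun t => g t * h t) <= 2 * M * cnorm1 g.
Proof.
move=> [rg ig] [rh ih] hM; rewrite /cnorm1.
have hr t : `|re h t| <= M := le_trans (nrm_Re _) (hM t).
have hi t : `|im h t| <= M := le_trans (nrm_Im _) (hM t).
rewrite (_ : re _ = fun t => re g t * re h t + re g t * 0 - im g t * im h t); last first.
  by apply/funext => t; rewrite mulr0 addr0; exact: ReM.
rewrite (_ : im (fun t => g t * h t) = fun t => re g t * im h t + im g t * re h t); last first.
  by apply/funext => t; exact: ImM.
under [X in norm1 X]eq_fun => t do rewrite mulr0 addr0 -mulrN.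
have hi' t : `|- im h t| <= M by rewrite normrN.
have mih : measurable_fun setT (fun t => - im h t) by exact: measurable_funN.
have h1 := norm1D (L1M rg rh hr) (L1M ig mih hi').
have h2 := norm1D (L1M rg ih hi) (L1M ig rh hr).
apply: (le_trans (lerD h1 h2)).
have h3 := norm1M rg rh hr; have h4 := norm1M ig mih hi'.
have h5 := norm1M rg ih hi; have h6 := norm1M ig rh hr.
move: h3 h4 h5 h6; rewrite -/(norm1 _); lra.
Qed.

Lemma cintfrom_le a g x : cL1 g -> nrm (cintfrom a g x) <= cnorm1 g.
Proof. by move=> [rg ig]; rewrite /nrm /= lerD//; exact: intfrom_le_norm1. Qed.

Lemma cintfromD a g h x : cL1 g -> cL1 h ->
  cintfrom a (fun t => g t + h t) x = cintfrom a g x + cintfrom a h x.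
Proof.
move=> [rg ig] [rh ih]; apply: complexP; rewrite ?ReD ?ImD /=.
  by rewrite -intfromD//; congr intfrom; apply/funext => t; exact: ReD.
by rewrite -intfromD//; congr intfrom; apply/funext => t; exact: ImD.
Qed.

Lemma cintfromZ a (c : C) g x : cL1 g ->
  cintfrom a (fun t => c * g t) x = c * cintfrom a g x.
Proof.
move=> [rg ig]; apply: complexP; rewrite ?ReM ?ImM /=.
  rewrite -!intfromZ// -intfromN; last exact: L1Z.
  rewrite -intfromD; [|exact: L1Z|by apply: L1N; exact: L1Z].
  by congr intfrom; apply/funext => t; exact: ReM.
rewrite -!intfromZ// -intfromD; [|exact: L1Z..].
by congr intfrom; apply/funext => t; exact: ImM.
Qed.

Lemma cintfrom_sum (I : Type) (s : seq I) a (F : I -> R -> C) x :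
  (forall i, cL1 (F i)) ->
  cintfrom a (fun t => \sum_(i <- s) F i t) x = \sum_(i <- s) cintfrom a (F i) x.
Proof.
move=> iF; elim: s => [|i s IH].
  under eq_fun do rewrite big_nil; rewrite big_nil /cintfrom /re /im /=.
  by rewrite intfrom0.
under eq_fun do rewrite big_cons.
by rewrite big_cons cintfromD// ?IH//; exact: cL1_sum.
Qed.

Lemma eq_cintfrom a x g h : cL1 g -> cL1 h ->
  {in `]Num.min a x, Num.max a x[, g =1 h} -> cintfrom a g x = cintfrom a h x.
Proof.
move=> [rg ig] [rh ih] gh; rewrite /cintfrom.
by congr (_ +i* _)%C; apply: eq_intfrom => // t /gh; rewrite /re /im => ->.
Qed.

Lemma cintfrom_add a b g x : cintfrom a g x = cintfrom a g b + cintfrom b g x.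
Proof. by apply: complexP; rewrite ?ReD ?ImD /= /intfrom; ring. Qed.

Lemma cintfrom_meas a g : cL1 g -> cmeas (cintfrom a g).
Proof. by move=> [rg ig]; split; exact: intfrom_measurable. Qed.

Lemma sum_pair (V : nmodType) (I J : finType) (F : I * J -> V) :
  \sum_p F p = \sum_i \sum_j F (i, j).
Proof. by rewrite pair_bigA; apply: eq_bigr => -[]. Qed.

(** Complex form of the Volterra equation, obtained by viewing multiplication by
    a complex number as a real two by two block. *)
Lemma cvolterra (I : finType) (A : I -> I -> R -> C) (b : I -> R -> C)
    (W : I -> R) (K a : R) :
  (forall i j, cL1 (A i j)) -> (forall i, cmeas (b i)) ->
  (forall i, 0 <= W i) -> 0 <= K -> (forall i x, nrm (b i x) <= K * W i) ->
  (forall i, \sum_j cnorm1 (A i j) * W j <= W i / 2) ->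
  exists z : I -> R -> C, [/\ forall i, cmeas (z i),
    forall i x, nrm (z i x) <= 4 * K * W i &
    forall i x, z i x = b i x + cintfrom a (fun t => \sum_j A i j t * z j t) x].
Proof.
move=> iA mb W0 K0 bK AW.
pose part (c : bool) (w : C) := if c then complex.Im w else complex.Re w.
pose A' (i j : I * bool) t : R :=
  match i.2, j.2 with
  | false, true => - im (A i.1 j.1) t
  | true, false => im (A i.1 j.1) t
  | _, _ => re (A i.1 j.1) t
  end.
pose b' (i : I * bool) t := part i.2 (b i.1 t).
have nA i j : norm1 (fun t => - im (A i j) t) = norm1 (im (A i j)).
  by rewrite /norm1; under eq_Rintegral do rewrite normrN.
have [| | | |||z [mz zK zE]] := @volterra R _ A' b' (fun i => W i.1) K a.
- move=> [i [|]] [j [|]]; rewrite /A' /=; have [rA iA'] := iA i j => //.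
  exact: L1N.
- by move=> [i [|]]; have [] := mb i.
- by move=> i.
- exact: K0.
- move=> [i c] x; apply: le_trans (bK i x); rewrite /b' /=.
  by case: c; [exact: nrm_Im|exact: nrm_Re].
- move=> [i c]; rewrite /= sum_pair /=.
  apply: le_trans (AW i); apply: ler_sum => j _.
  rewrite big_bool /= -mulrDl ler_wpM2r// /A' /cnorm1 /=.
  by case: c => /=; rewrite ?nA// addrC.
pose y i t : C := (z (i, false) t +i* z (i, true) t)%C.
have my i : cmeas (y i) by split; exact: mz.
have yK i x : nrm (y i x) <= 4 * K * W i.
  have h1 := zK (i, false) x; have h2 := zK (i, true) x.
  by rewrite /nrm /=; move: h1 h2 => /=; lra.
exists y; split => // i x.
apply: complexP; rewrite ?ReD ?ImD /= zE /b' /=; congr (_ + intfrom _ _ _).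
  apply/funext => t; rewrite /re Re_sum.
  rewrite sum_pair /=.
  apply: eq_bigr => j _; rewrite big_bool /A' /= ReM /= /re /im.
  by rewrite addrC mulNr.
apply/funext => t; rewrite /im Im_sum.
rewrite sum_pair /=.
by apply: eq_bigr => j _; rewrite big_bool /A' /= ImM /= /re /im.
Qed.

End ComplexPrimitive.

(** * Borel measurability of the derivative *)

Section DerivativeMeasurable.
Context {R : realType}.
Implicit Types (F : R -> R) (x : R).

Lemma within_itv_dnbhs x : 0 < x < 1 -> within `[0, 1]%classic x^' = x^'.
Proof.
move=> /andP[x0 x1]; apply/seteqP; split => A /=; last exact: cvg_within.
rewrite /within/= => H.
have nx : \forall t \near x^', `[0, 1]%classic t.
  apply: cvg_within.
  have : x \in `]0, 1[ by rewrite in_itv/= x0.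
  move=> /near_in_itvoo; apply: filterS => t; exact: subset_itv_oo_cc.
near=> t.
have : `[0, 1]%classic t by near: t.
by near: t.
Unshelve. all: by end_near. Qed.

Lemma derive01_int F x : 0 < x < 1 -> derive01 F x = lim (diff_quot F x t @[t --> x^']).
Proof. by move=> x01; rewrite /derive01 within_itv_dnbhs. Qed.

(** Denominators are cleared, so that the condition compares continuous functions
    of [x] and holds trivially when an increment vanishes. *)
Definition quot_osc F (k d : nat) (rs : rat * rat) : set R := [set x |
  let r := ratr rs.1 : R in let s := ratr rs.2 : R in
  `|r - x| < d.+1%:R^-1 -> `|s - x| < d.+1%:R^-1 ->
  `|(F r - F x) * (s - x) - (F s - F x) * (r - x)| <=
    k.+1%:R^-1 * (`|r - x| * `|s - x|)].

Lemma measurable_lt_continuous (f g : R -> R) :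
  continuous f -> continuous g -> measurable [set x | f x < g x].
Proof.
move=> /continuous_measurable_fun mf /continuous_measurable_fun mg.
have := @measurable_fun_ltr _ _ _ setT f g mf mg measurableT [set true].
rewrite setTI; apply.
by [].
Qed.

Lemma quot_osc_measurable F k d rs : continuous F -> measurable (quot_osc F k d rs).
Proof.
move=> cF; rewrite -[X in measurable X]setCK; apply: measurableC.
set r : R := ratr rs.1; set s : R := ratr rs.2.
rewrite (_ : ~` _ = [set x | `|r - x| < d.+1%:R^-1] `&`
   ([set x | `|s - x| < d.+1%:R^-1] `&`
   [set x | k.+1%:R^-1 * (`|r - x| * `|s - x|) <
     `|(F r - F x) * (s - x) - (F s - F x) * (r - x)|])); last first.
  apply/seteqP; split => x /=.
    rewrite /quot_osc /= -/r -/s => H; split; [|split].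
    - by apply: contrapT => h; apply: H => /h.
    - by apply: contrapT => h; apply: H => _ /h.
    - by rewrite ltNge; apply/negP => h; apply: H.
  by move=> [h1 [h2 h3]] H; move: h3; rewrite ltNge (H h1 h2).
have cB u : continuous (fun x : R => u - x).
  by move=> x; apply: cvgB; [exact: cvg_cst|exact: cvg_id].
have cFB u : continuous (fun x : R => u - F x).
  by move=> x; apply: cvgB; [exact: cvg_cst|exact: cF].
have cn (f : R -> R) : continuous f -> continuous (fun x => `|f x|).
  by move=> cf x; apply: cvg_norm; exact: cf.
have cc (u : R) : continuous (fun _ : R => u) by move=> x; exact: cvg_cst.
apply: measurableI; [|apply: measurableI]; apply: measurable_lt_continuous => //.
- exact/cn/cB.
- exact/cn/cB.
- move=> x; apply: cvgM; first exact: cvg_cst.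
  by apply: cvgM; [exact: (cn _ (cB r))|exact: (cn _ (cB s))].
- apply: cn => x; apply: cvgB; apply: cvgM; (exact: cFB || exact: cB).
Qed.

Definition quot_cauchy F : set R :=
  \bigcap_k \bigcup_d \bigcap_rs quot_osc F k d rs.

Lemma quot_cauchy_measurable F : continuous F -> measurable (quot_cauchy F).
Proof.
move=> cF; apply: bigcapT_measurable => k; apply: bigcup_measurable => d _.
rewrite -[X in measurable X]setCK setC_bigcap; apply: measurableC.
apply: countable_bigcupT_measurable => // rs.
by apply: measurableC; exact: quot_osc_measurable.
Qed.

Lemma diff_quot_osc F x r s (e : R) : r != x -> s != x ->
  (`|(F r - F x) * (s - x) - (F s - F x) * (r - x)| <= e * (`|r - x| * `|s - x|)) =
  (`|diff_quot F x r - diff_quot F x s| <= e).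
Proof.
move=> rx sx; have h : 0 < `|r - x| * `|s - x| by rewrite mulr_gt0// normr_gt0 subr_eq0.
rewrite -[RHS](ler_pM2r h) -!normrM; congr (`|_| <= _).
by rewrite /diff_quot; field; rewrite !subr_eq0 rx sx.
Qed.

Lemma quot_cauchyP F x : continuous F ->
  quot_cauchy F x <-> cvg (diff_quot F x t @[t --> x^']).
Proof.
move=> cF; split; last first.
  move=> /cvg_ex[l /cvgrPdist_lt Hl] k _.
  have k0 : 0 < k.+1%:R^-1 / 2 :> R by [].
  have [d /= d0 Hd] := Hl _ k0.
  have [m _ md] : exists2 m : nat, True & m.+1%:R^-1 < d.
    have := @near_infty_natSinv_lt R (PosNum d0).
    by move=> [N _ /(_ N (leqnn N))] /= h; exists N.
  exists m => // rs _; rewrite /quot_osc /= => hr hs.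
  have [/eqP|rx] := boolP (ratr rs.1 == x :> R).
    by move=> ->; rewrite !subrr mul0r mulr0 normr0 subr0 mul0r mulr0 normr0.
  have [/eqP|sx] := boolP (ratr rs.2 == x :> R).
    by move=> ->; rewrite !subrr mul0r mulr0 normr0 subr0 mulr0 mulr0 normr0.
  rewrite diff_quot_osc//.
  have h1 := Hd (ratr rs.1); have h2 := Hd (ratr rs.2).
  move: h1 h2; rewrite /= ![`|x - _|]distrC.
  move=> /(_ (lt_trans hr md) rx) h1 /(_ (lt_trans hs md) sx) h2.
  rewrite -[X in X - _](subrK l) -addrA (le_trans (ler_normD _ _))//.
  by rewrite [X in _ <= X]splitr lerD// ltW// distrC.
move=> H; apply: cauchy_cvg; apply: cauchy_exP => e e0.
have [k ke] : exists k : nat, k.+1%:R^-1 < e / 2 :> R.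
  have e20 : 0 < e / 2 by rewrite divr_gt0.
  have := @near_infty_natSinv_lt R (PosNum e20).
  by move=> [N _ /(_ N (leqnn N))] /= h; exists N.
have [d _ Hd] := H k I.
pose dl : R := d.+1%:R^-1; have dl0 : 0 < dl by rewrite /dl invr_gt0.
have cq t : t != x -> {for t, continuous (diff_quot F x)}.
  move=> tx; rewrite /continuous_at /diff_quot; apply: cvgM.
    by apply: cvgB; [exact: cF|exact: cvg_cst].
  apply: cvgV; first by rewrite subr_eq0.
  by apply: cvgB; [exact: cvg_id|exact: cvg_cst].
have ap t : t != x -> `|t - x| < dl ->
   exists r : rat, [/\ ratr r != x, `|ratr r - x| < dl &
     `|diff_quot F x t - diff_quot F x (ratr r)| < e / 8].
  move=> tx td.
  have : \forall u \near t, [/\ u != x, `|u - x| < dl &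
     `|diff_quot F x t - diff_quot F x u| < e / 8].
    have e80 : 0 < e / 8 by rewrite divr_gt0.
    have h1 : \forall u \near t, u != x.
      by apply: open_nbhs_nbhs; split => //; exact: open_neq.
    have h2 : \forall u \near t, `|u - x| < dl.
      have cn : `|u - x| @[u --> t] --> `|t - x|.
        by apply: cvg_norm; apply: cvgB; [exact: cvg_id|exact: cvg_cst].
      exact: (cvgr_lt _ cn).
    have /cvgrPdist_lt/(_ _ e80) h3 := cq t tx.
    by near=> u; split; near: u.
  move=> /nbhs_ballP[/= b b0 Hb].
  have [|z [bz [r _ rz]]] := @dense_rat R (ball t b) _ (ball_open _ _).
    by exists t; exact: ballxx.
  by exists r; rewrite rz; exact: Hb.
pose t0 := x + dl / 2.
have t0x : t0 != x by rewrite -subr_eq0 addrAC subrr add0r gt_eqF// divr_gt0.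
have t0d : `|t0 - x| < dl.
  by rewrite addrAC subrr add0r gtr0_norm ?divr_gt0// ltr_pdivrMr// ltr_pMr// ltr1n.
have [s [sx sd se]] := ap _ t0x t0d.
exists (diff_quot F x t0); exists dl => // t /= td tx.
rewrite distrC in td.
have [r [rx rd re_]] := ap _ tx td.
have := Hd (r, s) I; rewrite /quot_osc/= => /(_ rd sd).
rewrite diff_quot_osc// => rs.
suff : `|diff_quot F x t0 - diff_quot F x t| < e by [].
have -> : diff_quot F x t0 - diff_quot F x t =
  (diff_quot F x t0 - diff_quot F x (ratr s)) -
  (diff_quot F x (ratr r) - diff_quot F x (ratr s)) -
  (diff_quot F x t - diff_quot F x (ratr r)) by ring.
apply: (le_lt_trans (ler_normB _ _)).
apply: (@le_lt_trans _ _ (e / 8 + k.+1%:R^-1 + e / 8)).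
  apply: lerD; last exact: ltW.
  by apply: (le_trans (ler_normB _ _)); rewrite lerD// ltW.
by move: ke e0; move: (k.+1%:R^-1 : R) => z h1 h2; lra.
Unshelve. all: by end_near. Qed.

(** The derivative is only known to exist almost everywhere, and modifying a
    function on a null set may destroy Borel measurability. So the set where it
    exists is shown to be Borel, by a Cauchy criterion over rational points; on it
    the derivative is a limit of difference quotients, and off it [lim] takes a
    constant default value. *)
Lemma derive01_measurable F : continuous F ->
  measurable_fun (`]0, 1[%classic : set R) (derive01 F).
Proof.
move=> cF; pose I01 : set (measurableTypeR R) := `]0, 1[%classic.
have mI : measurable I01 by exact: measurable_itv.
have mA := quot_cauchy_measurable cF.
rewrite -[X in measurable_fun X _](setUIDK I01 (quot_cauchy F)).
have D01 x : I01 x -> derive01 F x = lim (diff_quot F x t @[t --> x^']).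
  by rewrite /I01 /= in_itv/= => /derive01_int.
apply/measurable_funU; [exact: measurableI|exact: measurableD|split].
- apply: (@measurable_fun_cvg _ _ _ _ (fun m x =>
    (F (x + m.+1%:R^-1) - F x) / m.+1%:R^-1)).
    move=> m; apply: measurable_funTS; apply: continuous_measurable_fun => x.
    apply: cvgM; last exact: cvg_cst.
    apply: cvgB; last exact: cF.
    apply: continuous_comp; last exact: cF.
    by apply: cvgD; [exact: cvg_id|exact: cvg_cst].
  move=> x [/D01 -> /(quot_cauchyP _ cF) cq].
  have := (cvgr_dnbhsP _ _ _).1 cq (fun m => x + m.+1%:R^-1).
  rewrite (_ : (fun m => diff_quot F x _) =
    (fun m => (F (x + m.+1%:R^-1) - F x) / m.+1%:R^-1)); last first.
    by apply/funext => m; rewrite /diff_quot [X in _ / X]addrAC subrr add0r.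
  apply; split=> [m|].
    by rewrite -subr_eq0 addrAC subrr add0r.
  rewrite -[X in _ --> X]addr0; apply: cvgD; first exact: cvg_cst.
  exact: cvg_harmonic.
- apply: (eq_measurable_fun (cst point)); last exact: measurable_cst.
  move=> x; rewrite inE => -[/D01 -> nq]; rewrite dvgP// => /(quot_cauchyP _ cF).
  by [].
Qed.
End DerivativeMeasurable.

(** * One-sided derivatives and cut-offs *)

Section DifferenceQuotients.
Context {R : realType}.
Local Notation C := R[i].
Implicit Types (f F : R -> R) (x : R).

Lemma within_dnbhs_proper x : 0 <= x <= 1 ->
  ProperFilter (within (`[0, 1]%classic : set R) x^').
Proof.
move=> /andP[x0 x1]; apply: Build_ProperFilter_ex => A.
rewrite /within /= => /nbhs_ballP[e /= e0 He].
pose d : R := Num.min (e / 2) (1 / 2).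
have d0 : 0 < d by rewrite lt_min !divr_gt0.
have de : d < e by rewrite gt_min; apply/orP; left; lra.
have d1 : d <= 1 / 2 by rewrite ge_min lexx orbT.
have [x2|x2] := leP x (1 / 2).
  exists (x + d); apply: He.
  - by rewrite /ball /= opprD addrA subrr sub0r normrN gtr0_norm.
  - by rewrite -subr_eq0 addrAC subrr add0r gt_eqF.
  - by rewrite /= in_itv/=; apply/andP; split; lra.
exists (x - d); apply: He.
- by rewrite /ball /= opprB addrCA subrr addr0 gtr0_norm.
- by rewrite -subr_eq0 addrAC subrr add0r oppr_eq0 gt_eqF.
- by rewrite /= in_itv/=; apply/andP; split; lra.
Qed.

Lemma diff_quot_cvg f F x : {in `[0, 1], f =1 F} -> 0 <= x <= 1 ->
  derivable F x 1 ->
  diff_quot f x t @[t --> within `[0, 1]%classic x^'] --> derive1 F x.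
Proof.
move=> fF x01 dF; apply/cvgrPdist_lt => e e0.
have : h^-1 *: (F (h + x) - F x) @[h --> 0^'] --> derive1 F x.
  move: dF; rewrite /derivable derive1E /derive => dF.
  apply: cvg_trans dF; apply: near_eq_cvg; near=> h.
  by rewrite /= scaler1.
move=> /cvgrPdist_lt /(_ e e0) [d /= d0 Hd].
exists d => // t /= xt tx t01; rewrite /diff_quot.
have h := Hd (t - x); rewrite /= sub0r normrN distrC in h.
have := h xt; rewrite subr_eq0 => /(_ tx); rewrite subrK.
by rewrite !fF ?in_itv//= mulrC.
Unshelve. all: by end_near. Qed.

Lemma derive01_eq f F x : {in `[0, 1], f =1 F} -> 0 <= x <= 1 ->
  derivable F x 1 -> derivable01 f x /\ derive01 f x = derive1 F x.
Proof.
move=> fF x01 dF; have h := diff_quot_cvg fF x01 dF.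
have PF := within_dnbhs_proper x01.
by split; [apply/cvg_ex; eexists; exact: h|exact: (cvg_lim _ h)].
Qed.

Lemma derive01_local f F x : {in `[0, 1], f =1 F} -> 0 <= x <= 1 ->
  derive01 f x = derive01 F x.
Proof.
move=> fF x01; have PF := within_dnbhs_proper x01.
rewrite /derive01; congr (lim _).
have H (g h : R -> R) : {in `[0, 1], g =1 h} ->
    \forall t \near within `[0, 1]%classic x^', diff_quot g x t = diff_quot h x t.
  by move=> gh; apply: filterS (withinT _ _) => t t01; rewrite /diff_quot !gh ?in_itv.
by apply/seteqP; split => A; apply: near_eq_cvg; apply: H => // t t01; rewrite fF.
Qed.

Lemma DopE (y : R -> C) x : Dop y x =
  (derive01 (im y) x +i* - derive01 (re y) x)%C.
Proof. by apply: complexP; rewrite ?ReM ?ImM /=; ring. Qed.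

End DifferenceQuotients.

Section Cut.
Context {R : realType}.
Local Notation C := R[i].
Local Notation mu := (@lebesgue_measure R).
Implicit Types (g h : R -> C) (i : interval R).

Definition cut i g : R -> C := fun t => if t \in i then g t else 0.

Lemma cut_in i g t : t \in i -> cut i g t = g t.
Proof. by rewrite /cut => ->. Qed.

Lemma cut_out i g t : t \notin i -> cut i g t = 0.
Proof. by rewrite /cut => /negbTE ->. Qed.

Lemma re_cut i g : re (cut i g) = re g \_ [set` i].
Proof.
by apply/funext => t; rewrite /re /cut patchE mem_setE; case: ifP.
Qed.

Lemma im_cut i g : im (cut i g) = im g \_ [set` i].
Proof.
by apply/funext => t; rewrite /im /cut patchE mem_setE; case: ifP.
Qed.

Lemma cutM i g h : cut i (fun t => g t * h t) = (fun t => cut i g t * h t).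
Proof. by apply/funext => t; rewrite /cut; case: ifP => //; rewrite mul0r. Qed.

Lemma cut_cL1 i g : mu.-integrable [set` i] (EFin \o re g) ->
  mu.-integrable [set` i] (EFin \o im g) -> cL1 (cut i g).
Proof.
move=> rg ig; split; rewrite /L1 ?re_cut ?im_cut -restrict_EFin.
  by apply/integrable_restrict => //; rewrite setTI.
by apply/integrable_restrict => //; rewrite setTI.
Qed.

Lemma cut_meas i g : cmeas g -> cmeas (cut i g).
Proof.
move=> [rg ig]; split; rewrite ?re_cut ?im_cut; apply/(measurable_restrictT _ _).1 => //;
  exact: measurable_funTS.
Qed.

Lemma cut_bounded_cL1 (a b : R) (s t : bool) g (M : R) : cmeas g ->
  (forall x, x \in Interval (BSide s a) (BSide t b) -> nrm (g x) <= M) ->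
  cL1 (cut (Interval (BSide s a) (BSide t b)) g).
Proof.
move=> mg gM; set i := Interval _ _.
rewrite (_ : cut i g = (fun t => cut i (fun=> 1) t * cut i g t)); last first.
  by apply/funext => x; rewrite /cut; case: ifP; rewrite ?mul1r ?mul0r.
apply: (@cL1M _ _ _ (Num.max M 0)).
- have -> : cut i (fun=> 1) = (fun t => (\1_[set` i] t)%:C%C).
    by apply/funext => x; rewrite /cut indicE mem_setE; case: ifP.
  by split; [exact: integrable_indic_itv|exact: L10].
- exact: cut_meas.
- move=> x; rewrite le_max /cut; case: ifP => xi; first by rewrite gM.
  by rewrite nrm0 lexx orbT.
Qed.

End Cut.

(** * Integral form of the differential equation *)

Section QuasiSolutions.
Context {R : realType}.
Local Notation C := R[i].
Local Notation mu := (@lebesgue_measure R).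
Variables (n : nat) (p : 'I_n.-1 -> R -> C).
Hypothesis n_gt0 : (0 < n)%N.
Hypothesis hp : forall k, summable01 (p k).

Definition lower_terms (Y : nat -> R -> C) : R -> C :=
  fun t => \sum_(j < n.-1) cut `]0, 1[ (p j) t * Y j t.

(** The derivative of [Y k] in the first-order system equivalent to
    [l(y) = f]. *)
Definition slope (Y : nat -> R -> C) (f : R -> C) (k : nat) : R -> C :=
  cut `[0, 1] (fun t => 'i%C * (if (k.+1 < n)%N then Y k.+1 t else f t - lower_terms Y t)).

(** The quasi-derivatives [Y k] of a solution of [l(y) = f]: integral equations
    make sense for summable coefficients and are stable under linear
    combinations, unlike the pointwise operator [Dop]. *)
Record qsol (Y : nat -> R -> C) (f : R -> C) : Prop := QSol {
  qsol_meas : forall k, cmeas (Y k);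
  qsol_bounded : exists M, forall k x, nrm (Y k x) <= M;
  qsol_rhs_meas : cmeas f;
  qsol_rhs_bounded : exists M, forall x, nrm (f x) <= M;
  qsol_eq : forall k x, (k < n)%N -> 0 <= x <= 1 ->
    Y k x = Y k 0 + cintfrom 0 (slope Y f k) x
}.

Lemma coef_cL1 j : cL1 (cut `]0, 1[ (p j)).
Proof. by have [rp ip] := hp j; exact: cut_cL1. Qed.

Lemma lower_terms_cL1 Y M : (forall k, cmeas (Y k)) ->
  (forall k x, nrm (Y k x) <= M) -> cL1 (lower_terms Y).
Proof.
move=> mY YM; apply: cL1_sum => j; apply: (cL1M (coef_cL1 j) (mY j) (YM j)).
Qed.

Lemma cut_lower_terms Y : cut `[0, 1] (lower_terms Y) = lower_terms Y.
Proof.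
apply/funext => t; rewrite {1}/cut; case: ifPn => // t01.
rewrite /lower_terms big1// => j _; rewrite cut_out ?mul0r//.
by apply: contra t01; exact: subset_itv_oo_cc.
Qed.

Lemma slope_cL1 Y f k : qsol Y f -> cL1 (slope Y f k).
Proof.
move=> [mY [M YM] mf [Mf fM] _]; rewrite /slope.
under [X in cut _ X]eq_fun do rewrite mulrC; rewrite cutM.
under eq_fun do rewrite mulrC.
apply: cL1Z; case: (boolP (k.+1 < n)%N) => kn.
  by apply: (@cut_bounded_cL1 _ _ _ _ _ _ M) => // x _.
rewrite (_ : cut _ _ = fun t => cut `[0, 1] f t + (-1) * lower_terms Y t); last first.
  apply/funext => t; rewrite -[in RHS]cut_lower_terms mulN1r.
  by rewrite /cut; case: ifP => //; rewrite subrr.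
apply: cL1D; first by apply: (@cut_bounded_cL1 _ _ _ _ _ _ Mf).
by apply: cL1Z; exact: (lower_terms_cL1 mY YM).
Qed.

Section Regularity.
Variables (Y : nat -> R -> C) (f : R -> C).
Hypothesis qY : qsol Y f.

Let ext k x : C := Y k 0 + cintfrom 0 (slope Y f k) x.

Let extE k x : (k < n)%N -> 0 <= x <= 1 -> Y k x = ext k x.
Proof. exact: (qsol_eq qY). Qed.

Let ext_re k : re (ext k) = 
  fun x => complex.Re (Y k 0) - prim (re (slope Y f k)) 0 + prim (re (slope Y f k)) x.
Proof. by apply/funext => x; rewrite /re /ext ReD /= /intfrom; ring. Qed.

Let ext_im k : im (ext k) = 
  fun x => complex.Im (Y k 0) - prim (im (slope Y f k)) 0 + prim (im (slope Y f k)) x.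
Proof. by apply/funext => x; rewrite /im /ext ImD /= /intfrom; ring. Qed.

Let ext_continuous k : continuous (re (ext k)) /\ continuous (im (ext k)).
Proof.
have [rs is_] := slope_cL1 k qY; rewrite ext_re ext_im.
by split=> x; apply: cvgD; try exact: cvg_cst; exact: prim_continuous.
Qed.

Lemma const_prim_derive (g : R -> R) (c x d : R) :
  derivable (prim g) x 1 /\ derive1 (prim g) x = d ->
  derivable (fun t => c + prim g t) x 1 /\ derive1 (fun t => c + prim g t) x = d.
Proof.
move=> [dg <-]; have dc : derivable (fun=> c : R) x 1 by exact: derivable_cst.
split; first exact: derivableD.
by rewrite !derive1E deriveD// derive_cst add0r.
Qed.

(** At the end points the one-sided derivative is obtained by extending the
    integrand continuously to a neighbourhood of the unit interval. *)
Let ext_step k x : (k.+1 < n)%N -> 0 <= x <= 1 ->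
  exists F : R -> R * R, [/\ {in `[0, 1], re (ext k) =1 (fun t => (F t).1)},
     {in `[0, 1], im (ext k) =1 (fun t => (F t).2)},
     derivable (fun t => (F t).1) x 1 /\ derive1 (fun t => (F t).1) x =
        complex.Re ('i%C * Y k.+1 x) &
     derivable (fun t => (F t).2) x 1 /\ derive1 (fun t => (F t).2) x =
        complex.Im ('i%C * Y k.+1 x)].
Proof.
move=> kn x01.
pose g0 t := 'i%C * ext k.+1 t.
have [cr ci] := ext_continuous k.+1.
have g0r : re g0 = fun t => - im (ext k.+1) t.
  by apply/funext => t; rewrite /re /g0 ReM /= mul0r mul1r sub0r.
have g0i : im g0 = fun t => re (ext k.+1) t.
  by apply/funext => t; rewrite /im /g0 ImM /= mul0r mul1r add0r.
have cg0r : continuous (re g0) by rewrite g0r => t; apply: cvgN; exact: ci.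
have cg0i : continuous (im g0) by rewrite g0i.
pose g := cut `[- 1, 2] g0.
have ig : cL1 g.
  apply: cut_cL1; apply: continuous_compact_integrable;
    by [exact: segment_compact|exact: continuous_subspaceT].
have near_in : \forall t \near x, t \in (`[- 1, 2] : interval R).
  have : x \in (`](-1), 2[ : interval R).
    by rewrite in_itv/=; move: x01 => /andP[x0 x1]; apply/andP; split; lra.
  by move=> /near_in_itvoo; apply: filterS => t; exact: subset_itv_oo_cc.
have cg (h : C -> R) : {for x, continuous (fun t => h (g0 t))} ->
    {for x, continuous (fun t => h (g t))}.
  move=> ch; rewrite /continuous_at.
  have xin : x \in (`[- 1, 2] : interval R) by exact: nbhs_singleton near_in.
  have gx0 : g x = g0 x by rewrite /g cut_in.
  change (h (g t) @[t --> x] --> h (g x)); rewrite gx0; apply: cvg_trans ch; apply: near_eq_cvg.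
  by apply: filterS near_in => t tin; rewrite /g cut_in.
have [rs is_] := ig.
have Dr := prim_derivable rs (cg (@complex.Re R) (cg0r x)).
have Di := prim_derivable is_ (cg (@complex.Im R) (cg0i x)).
have gx : g x = 'i%C * Y k.+1 x.
  rewrite /g cut_in ?(nbhs_singleton near_in)// /g0 -extE//.
pose F t := (complex.Re (Y k 0) - prim (re g) 0 + prim (re g) t,
             complex.Im (Y k 0) - prim (im g) 0 + prim (im g) t).
have sg t : t \in `[0, 1] -> cintfrom 0 (slope Y f k) t = cintfrom 0 g t.
  rewrite in_itv/= => /andP[t0 t1]; apply: eq_cintfrom => //; first exact: slope_cL1.
  move=> u; rewrite min_l// max_r// in_itv/= => /andP[u0 ut].
  rewrite /slope kn /g !cut_in ?in_itv/=.
  - by rewrite /g0 -extE// (ltW u0) (le_trans (ltW ut)).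
  - by apply/andP; split; lra.
  - by rewrite (ltW u0) (le_trans (ltW ut)).
exists F; split.
- move=> t tin; rewrite /re /ext sg// ReD /= /intfrom; ring.
- move=> t tin; rewrite /im /ext sg// ImD /= /intfrom; ring.
- by apply: const_prim_derive; rewrite -gx; exact: Dr.
- by apply: const_prim_derive; rewrite -gx; exact: Di.
Qed.

Lemma qsol_Dop_step (y : R -> C) k x : (k.+1 < n)%N -> 0 <= x <= 1 ->
  {in `[0, 1], y =1 Y k} ->
  [/\ derivable01 (re y) x, derivable01 (im y) x & Dop y x = Y k.+1 x].
Proof.
move=> kn x01 yY; have [F [rF iF [dr dr'] [di di']]] := ext_step kn x01.
have yext t : t \in `[0, 1] -> y t = ext k t.
  by move=> tin; rewrite yY// extE//; exact: ltnW.
have ry : {in `[0, 1], re y =1 (fun t => (F t).1)}.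
  by move=> t tin; rewrite -rF// /re yext.
have iy : {in `[0, 1], im y =1 (fun t => (F t).2)}.
  by move=> t tin; rewrite -iF// /im yext.
have [d1 e1] := derive01_eq ry x01 dr; have [d2 e2] := derive01_eq iy x01 di.
split => //; rewrite DopE e1 e2 dr' di'.
by apply: complexP; rewrite /= ?ReM ?ImM /=; ring.
Qed.

Lemma qsol_iter_Dop k : (k < n)%N -> {in `[0, 1], iter k Dop (Y 0%N) =1 Y k}.
Proof.
elim: k => [//|k IH] kn x; rewrite in_itv/= => x01.
by have [] := qsol_Dop_step kn x01 (IH (ltnW kn)).
Qed.

(** For the last derivative the integrand is merely integrable, and Lebesgue's
    differentiation theorem takes over. *)
Lemma qsol_Dop_last : {ae mu, forall x, x \in `]0, 1[ ->
  Dop (iter n.-1 Dop (Y 0%N)) x = f x - \sum_(j < n.-1) p j x * Y j x}.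
Proof.
have [rs is_] := slope_cL1 n.-1 qY.
have := prim_derivable_ae rs; have := prim_derivable_ae is_.
apply: filterS2; first exact: (ae_filter_ringOfSetsType mu).
move=> x Di Dr x01.
have x01' : 0 <= x <= 1 by have := subset_itv_oo_cc x01; rewrite in_itv.
have nn : (n.-1 < n)%N by rewrite prednK.
have ry : {in `[0, 1], re (iter n.-1 Dop (Y 0%N)) =1 re (ext n.-1)}.
  move=> t tin; rewrite /re qsol_iter_Dop// extE//.
have iy : {in `[0, 1], im (iter n.-1 Dop (Y 0%N)) =1 im (ext n.-1)}.
  move=> t tin; rewrite /im qsol_iter_Dop// extE//.
rewrite ext_re in ry; rewrite ext_im in iy.
have [dr er] := const_prim_derive (complex.Re (Y n.-1 0) - prim (re (slope Y f n.-1)) 0) Dr.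
have [di ei] := const_prim_derive (complex.Im (Y n.-1 0) - prim (im (slope Y f n.-1)) 0) Di.
rewrite DopE (derive01_eq ry x01' dr).2 er (derive01_eq iy x01' di).2 ei.
rewrite /re /im /slope cut_in ?subset_itv_oo_cc// prednK// ltnn.
rewrite /lower_terms; under [in RHS]eq_bigr do rewrite -(cut_in _ x01).
by apply: complexP; rewrite /= ?ReM ?ImM /=; ring.
Qed.

Lemma qsol_lexpr_ae : {ae mu, forall x, x \in `]0, 1[ -> lexpr p (Y 0%N) x = f x}.
Proof.
have := qsol_Dop_last; apply: filterS; first exact: (ae_filter_ringOfSetsType mu).
move=> x Dx x01.
rewrite /lexpr -{1}(prednK n_gt0) iterS Dx//.
rewrite -[RHS](subrK (\sum_(j < n.-1) p j x * Y j x)); congr (_ + _).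
apply: eq_bigr => j _; rewrite qsol_iter_Dop//; first last.
  exact: subset_itv_oo_cc.
by rewrite (ltn_trans (ltn_ord j))// prednK.
Qed.

End Regularity.
End QuasiSolutions.

(** * Membership in the domain *)

Section DomainMembership.
Context {R : realType}.
Local Notation C := R[i].
Local Notation mu := (@lebesgue_measure R).
Local Notation I01 := (`]0, 1[%classic : set (measurableTypeR R)).

Lemma abs_cont01_cintfrom (y g : R -> C) (c : C) : cL1 g ->
  {in `[0, 1], forall x, y x = c + cintfrom 0 g x} -> abs_cont01 y.
Proof.
move=> [rg ig] yE e e0; have e20 : 0 < e / 2 by rewrite divr_gt0.
have [d1 d10 H1] := prim_abs_cont rg e20.
have [d2 d20 H2] := prim_abs_cont ig e20.
exists (Num.min d1 d2); first by rewrite lt_min d10.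
move=> m a b ab disj; rewrite lt_min => /andP[h1 h2].
have lab i : a i < b i by have [] := ab i.
have {}H1 := H1 m a b lab disj h1; have {}H2 := H2 m a b lab disj h2.
rewrite [e]splitr; apply: le_lt_trans (ltrD H1 H2).
rewrite -big_split /=; apply: ler_sum => i _.
have [a0 aibi b1] := ab i.
have -> : y (b i) - y (a i) = ((prim (re g) (b i) - prim (re g) (a i)) +i*
    (prim (im g) (b i) - prim (im g) (a i)))%C.
  rewrite !yE ?in_itv/=; last 2 first.
  - by rewrite a0 (le_trans _ b1)// ltW.
  - by rewrite b1 (le_trans a0)// ltW.
  by apply: complexP; rewrite ?ReD ?ImD ?ReN ?ImN ?ReD ?ImD /= /intfrom; ring.
by apply: (le_trans (normc_le_nrm _)).
Qed.

Definition cmeas01 (g : R -> C) :=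
  measurable_fun I01 (re g) /\ measurable_fun I01 (im g).

Lemma cmeas01D g h : cmeas01 g -> cmeas01 h -> cmeas01 (fun t => g t + h t).
Proof.
move=> [rg ig] [rh ih]; split.
  rewrite (_ : re _ = fun t => re g t + re h t); first exact: measurable_funD.
  by apply/funext => t; exact: ReD.
rewrite (_ : im _ = fun t => im g t + im h t); first exact: measurable_funD.
by apply/funext => t; exact: ImD.
Qed.

Lemma cmeas01M g h : cmeas01 g -> cmeas01 h -> cmeas01 (fun t => g t * h t).
Proof.
move=> [rg ig] [rh ih]; split.
  rewrite (_ : re _ = fun t => re g t * re h t - im g t * im h t).
    by apply: measurable_funB; exact: measurable_funM.
  by apply/funext => t; exact: ReM.
rewrite (_ : im _ = fun t => re g t * im h t + im g t * re h t).
  by apply: measurable_funD; exact: measurable_funM.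
by apply/funext => t; exact: ImM.
Qed.

Lemma cmeas_cmeas01 g : cmeas g -> cmeas01 g.
Proof. by move=> [rg ig]; split; exact: measurable_funTS. Qed.

Lemma eq_cmeas01 g h : {in `]0, 1[, g =1 h} -> cmeas01 g -> cmeas01 h.
Proof.
move=> gh [rg ig]; split.
  by apply: eq_measurable_fun rg => x; rewrite inE => xI; rewrite /re gh.
by apply: eq_measurable_fun ig => x; rewrite inE => xI; rewrite /im gh.
Qed.

Lemma integral01_ae (u v : R -> C) : cmeas01 u -> cmeas01 v ->
  {ae mu, forall x, x \in `]0, 1[ -> u x = v x} -> integral01 u = integral01 v.
Proof.
move=> [ru iu] [rv iv] uv; rewrite /integral01 /Rintegral.
congr (fine _ +i* fine _)%C; apply: ae_eq_integral => //.
- exact/measurable_EFinP.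
- exact/measurable_EFinP.
- move: uv; apply: filterS; first exact: (ae_filter_ringOfSetsType mu).
  by move=> x uv xI; congr EFin; rewrite /re uv//.
- exact/measurable_EFinP.
- exact/measurable_EFinP.
- move: uv; apply: filterS; first exact: (ae_filter_ringOfSetsType mu).
  by move=> x uv xI; congr EFin; rewrite /im uv//.
Qed.

Variables (n : nat) (p : 'I_n.-1 -> R -> C) (bc : bconds C n).
Hypothesis n_gt0 : (0 < n)%N.
Hypothesis hp : forall k, summable01 (p k).
Variables (Y : nat -> R -> C) (f : R -> C).
Hypothesis qY : qsol p Y f.

Lemma qsol_continuous_ext k : (k < n)%N -> exists F G : R -> R,
  [/\ continuous F, continuous G, {in `[0, 1], re (Y k) =1 F} &
      {in `[0, 1], im (Y k) =1 G}].
Proof.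
move=> kn; have [rs is_] := slope_cL1 hp k qY.
exists (fun x => complex.Re (Y k 0) + intfrom 0 (re (slope p Y f k)) x).
exists (fun x => complex.Im (Y k 0) + intfrom 0 (im (slope p Y f k)) x).
have c0 (c : R) g : L1 g -> continuous (fun x => c + intfrom 0 g x).
  move=> ig x; apply: cvgD; first exact: cvg_cst.
  by apply: cvgB; [exact: prim_continuous|exact: cvg_cst].
split; [exact: c0|exact: c0|..] => x; rewrite in_itv/= => x01.
  by rewrite /re (qsol_eq qY kn x01) ReD.
by rewrite /im (qsol_eq qY kn x01) ImD.
Qed.

Lemma qsol_lexpr_meas : cmeas01 (lexpr p (Y 0%N)).
Proof.
have nn : (n.-1 < n)%N by rewrite prednK.
have [F [G [cF cG FE GE]]] := qsol_continuous_ext nn.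
apply: (@eq_cmeas01 (fun x => Dop (Y n.-1) x + lower_terms p Y x)).
  move=> x x01; rewrite /lexpr.
  have -> : iter n Dop (Y 0%N) x = Dop (iter n.-1 Dop (Y 0%N)) x.
    by rewrite -iterS prednK.
  congr (_ + _).
    rewrite !DopE; have x01' := subset_itv_oo_cc x01; rewrite in_itv/= in x01'.
    by congr (_ +i* - _)%C; apply: derive01_local => // t tin;
      rewrite /re /im (qsol_iter_Dop hp qY).
  apply: eq_bigr => j _; rewrite cut_in// (qsol_iter_Dop hp qY)//.
    by rewrite (ltn_trans (ltn_ord j))// prednK.
  exact: subset_itv_oo_cc.
apply: cmeas01D; last first.
  have [M YM] := qsol_bounded qY.
  by apply/cmeas_cmeas01/cL1_meas/(lower_terms_cL1 hp (qsol_meas qY) YM).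
apply: (@eq_cmeas01 (fun x => (derive01 G x +i* - derive01 F x)%C)).
  move=> x x01; rewrite DopE.
  have x01' := subset_itv_oo_cc x01; rewrite in_itv/= in x01'.
  by rewrite (derive01_local FE x01') (derive01_local GE x01').
split; rewrite /re /im /=; first exact: derive01_measurable.
by apply: measurable_funN; exact: derive01_measurable.
Qed.

Lemma sqr_normc_ReIm (z : C) : Normc.normc z ^+ 2 = complex.Re z ^+ 2 + complex.Im z ^+ 2.
Proof. by case: z => a b /=; rewrite sqr_sqrtr// addr_ge0 ?sqr_ge0. Qed.

Lemma qsol_lexpr_L2 : L2_01 (lexpr p (Y 0%N)).
Proof.
have [rl il] := qsol_lexpr_meas.
split => //.
have [M fM] := qsol_rhs_bounded qY.
have M0 : 0 <= M := le_trans (nrm_ge0 _) (fM 0).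
apply: (@le_lt_trans _ _ (\int[mu]_(x in I01) ((M ^+ 2)%:E))%E).
  apply: ae_ge0_le_integral => //.
  - by move=> x _; rewrite lee_fin sqr_ge0.
  - apply/measurable_EFinP.
    rewrite (_ : (fun x => _) = (fun x => re (lexpr p (Y 0%N)) x ^+ 2 +
      im (lexpr p (Y 0%N)) x ^+ 2)).
      by apply: measurable_funD; exact: measurable_funX.
    by apply/funext => x; exact: sqr_normc_ReIm.
  - by move=> x _; rewrite lee_fin sqr_ge0.
  - have := qsol_lexpr_ae n_gt0 hp qY; apply: filterS; first exact: (ae_filter_ringOfSetsType mu).
    move=> x lf xI.
    rewrite lf// lee_fin ler_pXn2r// ?nnegrE//.
      by rewrite (le_trans (normc_le_nrm _)).
    by case: (f x) => a b /=; rewrite sqrtr_ge0.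
rewrite integral_cst//= lebesgue_measure_itv/= lte_fin ltr01 oppr0 adde0 mule1.
by rewrite ltry.
Qed.

Lemma qsol_in_domain : (forall j : 'I_n, \sum_(e : bool)
    (Y j e%:R *: bc_lead bc e j + \sum_(s < j) Y s e%:R *: bc_low bc e s) = 0) ->
  in_domain p bc (Y 0%N).
Proof.
move=> hbc; split.
- move=> k x kn x01; have [] := qsol_Dop_step hp qY kn x01 (qsol_iter_Dop hp qY (ltnW kn)).
  by [].
- move=> k kn; apply: (@abs_cont01_cintfrom _ (slope p Y f k) (Y k 0)).
    exact: slope_cL1.
  move=> x xin; rewrite (qsol_iter_Dop hp qY)// (qsol_eq qY) -?in_itv//.
- exact: qsol_lexpr_L2.
- move=> j; rewrite -[RHS](hbc j); apply: eq_bigr => e _.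
  have e01 : (e%:R : R) \in `[0, 1] by rewrite in_itv/=; case: e; rewrite ?lexx ?ler01.
  rewrite (qsol_iter_Dop hp qY)//; congr (_ + _).
  apply: eq_bigr => s _; rewrite (qsol_iter_Dop hp qY)//.
  exact: ltn_trans (ltn_ord s) (ltn_ord j).
Qed.

(** The inner product only sees [f]: Green's formula will be applied to smooth
    profiles and never to the summable coefficients. *)
Lemma qsol_inner : inner01 (lexpr p (Y 0%N)) (Y 0%N) =
  integral01 (fun x => f x * (Y 0%N x)^*%C).
Proof.
have mY : cmeas01 (fun x => (Y 0%N x)^*%C).
  by apply/cmeas_cmeas01/cmeasJ; exact: (qsol_meas qY).
apply: integral01_ae.
- exact: cmeas01M qsol_lexpr_meas mY.
- by apply: cmeas01M mY; apply: cmeas_cmeas01; exact: (qsol_rhs_meas qY).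
- have := qsol_lexpr_ae n_gt0 hp qY; apply: filterS; first exact: (ae_filter_ringOfSetsType mu).
    move=> x lf xI.
  by rewrite lf.
Qed.

End DomainMembership.

(** * Calculus of complex polynomials *)

Section PolynomialCalculus.
Context {R : realType}.
Local Notation C := R[i].
Implicit Types (P Q G : {poly C}) (x : R).

Definition polyD P : {poly C} := (- 'i%C) *: P^`().

Lemma is_derive_poly G x :
  is_derive x 1 (fun t => complex.Re G.[t%:C%C]) (complex.Re G^`().[x%:C%C]) /\
  is_derive x 1 (fun t => complex.Im G.[t%:C%C]) (complex.Im G^`().[x%:C%C]).
Proof.
elim/poly_ind: G x => [|G c IH] x.
  rewrite deriv0 horner0; split.
    rewrite (_ : (fun t => _) = fun=> 0); first exact: is_derive_cst.
    by apply/funext => t; rewrite horner0.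
  rewrite (_ : (fun t => _) = fun=> 0); first exact: is_derive_cst.
  by apply/funext => t; rewrite horner0.
have [IHr IHi] := IH x.
split.
  rewrite (_ : (fun t => _) = fun t => complex.Re G.[t%:C%C] * t + complex.Re c).
    apply: is_derive_eq.
    rewrite derivMXaddC hornerD hornerMX.
    by rewrite ReD ReM /= mulr0 subr0 /GRing.scale /=; ring.
  by apply/funext => t; rewrite hornerMXaddC ReD ReM /= mulr0 subr0.
rewrite (_ : (fun t => _) = fun t => complex.Im G.[t%:C%C] * t + complex.Im c).
  apply: is_derive_eq.
  rewrite derivMXaddC hornerD hornerMX.
  by rewrite ImD ImM /= mulr0 add0r /GRing.scale /=; ring.
by apply/funext => t; rewrite hornerMXaddC ImD ImM /= mulr0 add0r.
Qed.

Lemma nrm_poly_bounded G : exists2 M : R, 0 <= M &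
  forall t : R, `|t| <= 1 -> nrm G.[t%:C%C] <= M.
Proof.
exists (\sum_(i < size G) nrm G`_i); first by apply: sumr_ge0 => i _; exact: nrm_ge0.
move=> t t1; rewrite horner_coef (le_trans (nrm_sum _ _))//; apply: ler_sum => i _.
rewrite -rmorphXn /= mulrC nrmZ ler_piMl ?nrm_ge0// normrX.
by rewrite exprn_ile1.
Qed.

Lemma poly_affine_meas G (c e : R) : cmeas (fun x => G.[((x - e) / c)%:C%C]).
Proof.
have ca : continuous (fun x : R => (x - e) / c).
  move=> x; apply: cvgM; last exact: cvg_cst.
  by apply: cvgB; [exact: cvg_id|exact: cvg_cst].
split; apply: continuous_measurable_fun => x.
  apply: (@continuous_comp _ _ _ (fun x : R => (x - e) / c)
    (fun t => complex.Re G.[t%:C%C])); first exact: ca.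
  have [[d _] _] := is_derive_poly G ((x - e) / c).
  by apply: differentiable_continuous; exact/derivable1_diffP.
apply: (@continuous_comp _ _ _ (fun x : R => (x - e) / c)
  (fun t => complex.Im G.[t%:C%C])); first exact: ca.
have [_ [d _]] := is_derive_poly G ((x - e) / c).
by apply: differentiable_continuous; exact/derivable1_diffP.
Qed.

Lemma intfrom_FTC (a x : R) (g h F : R -> R) : L1 g -> continuous h ->
  (forall t : R, is_derive t 1 F (h t)) ->
  {in `]Num.min a x, Num.max a x[, g =1 h} -> intfrom a g x = F x - F a.
Proof.
move=> ig ch dF; wlog ax : a x / a <= x => [H|] gh.
  case: (leP a x) => [ax|/ltW xa]; first exact: H.
  by rewrite /intfrom -opprB -/(intfrom x g a) H ?opprB// minC maxC.
move: ax gh; rewrite le_eqVlt => /predU1P[<- _|ax].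
  by rewrite /intfrom !subrr.
rewrite min_l ?(ltW ax)// max_r ?(ltW ax)// => gh.
rewrite /intfrom prim_itv ?(ltW ax)//.
have -> : \int[lebesgue_measure]_(t in `]a, x]) g t = \int[lebesgue_measure]_(t in `[a, x]) h t.
  have ih : (@lebesgue_measure R).-integrable `[a, x] (EFin \o h).
    apply: continuous_compact_integrable; first exact: segment_compact.
    exact: continuous_subspaceT.
  rewrite -Rintegral_itv_obnd_cbnd; last first.
    by apply: integrableS ih => //; exact: subset_itv_oc_cc.
  rewrite -!Rintegral_itv_bndo_bndc; last 2 first.
  - by apply: integrableS ih => //; exact: subset_itv_oo_cc.
  - exact: L1S.
  by apply: eq_Rintegral => t; rewrite inE; exact: gh.
rewrite /Rintegral (@continuous_FTC2 _ h F)//.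
- exact: continuous_subspaceT.
- have cF t : F @ t --> F t.
    have [d _] := dF t.
    by apply: differentiable_continuous; exact/derivable1_diffP.
  split.
  + by move=> t _; have [] := dF t.
  + by apply: cvg_at_right_filter; exact: cF.
  + by apply: cvg_at_left_filter; exact: cF.
- by move=> t _; rewrite derive1E; have [_] := dF t.
Qed.

Lemma is_derive_affine (F : R -> R) (c e x d : R) : c != 0 ->
  is_derive ((x - e) / c) 1 F d ->
  is_derive x 1 (fun t => c * F ((t - e) / c)) d.
Proof.
move=> c0 dF.
have d1 : is_derive x 1 (fun t : R => (t - e) / c) c^-1.
  by apply: is_derive_eq; rewrite /GRing.scale /= ; ring.
have d2 := @is_derive1_comp _ F (fun t : R => (t - e) / c) x _ _ dF d1.
have d3 := is_deriveZ c d2.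
apply: (is_derive_eq d3).
by rewrite /GRing.scale /=; field.
Qed.

Lemma cintfrom_poly (G : {poly C}) (a x c e : R) (g : R -> C) : c != 0 -> cL1 g ->
  {in `]Num.min a x, Num.max a x[, forall t, g t = G^`().[((t - e) / c)%:C%C]} ->
  cintfrom a g x = c%:C%C * (G.[((x - e) / c)%:C%C] - G.[((a - e) / c)%:C%C]).
Proof.
move=> c0 [rg ig] gG.
have cphi : continuous (fun t : R => (t - e) / c).
  move=> t; apply: cvgM; last exact: cvg_cst.
  by apply: cvgB; [exact: cvg_id|exact: cvg_cst].
have cRe : continuous (fun t : R => complex.Re G^`().[((t - e) / c)%:C%C]).
  move=> t; apply: (@continuous_comp _ _ _ (fun x : R => (x - e) / c)
    (fun t => complex.Re G^`().[t%:C%C])); first exact: cphi.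
  have [[d _] _] := is_derive_poly G^`() ((t - e) / c).
  by apply: differentiable_continuous; exact/derivable1_diffP.
have cIm : continuous (fun t : R => complex.Im G^`().[((t - e) / c)%:C%C]).
  move=> t; apply: (@continuous_comp _ _ _ (fun x : R => (x - e) / c)
    (fun t => complex.Im G^`().[t%:C%C])); first exact: cphi.
  have [_ [d _]] := is_derive_poly G^`() ((t - e) / c).
  by apply: differentiable_continuous; exact/derivable1_diffP.
have dRe (t : R) := is_derive_affine c0 (is_derive_poly G ((t - e) / c)).1.
have dIm (t : R) := is_derive_affine c0 (is_derive_poly G ((t - e) / c)).2.
have gRe : {in `]Num.min a x, Num.max a x[,
    re g =1 (fun t : R => complex.Re G^`().[((t - e) / c)%:C%C])}.
  by move=> t tin; rewrite /re gG.
have gIm : {in `]Num.min a x, Num.max a x[,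
    im g =1 (fun t : R => complex.Im G^`().[((t - e) / c)%:C%C])}.
  by move=> t tin; rewrite /im gG.
apply: complexP; rewrite ?ReM ?ImM /= mul0r.
  by rewrite (intfrom_FTC rg cRe dRe gRe) ReD ReN; ring.
by rewrite (intfrom_FTC ig cIm dIm gIm) ImD ImN; ring.
Qed.

End PolynomialCalculus.

(** * Boundary layers and their polynomial profiles *)

Section Layers.
Context {R : realType}.
Local Notation C := R[i].
Local Notation mu := (@lebesgue_measure R).
Implicit Types (e : bool) (c x t : R) (P : {poly C}).

Definition layer_itv e c : interval R := if e then `[1 - c, 1] else `[0, c].

Definition layer_base e c : R := if e then 1 - c else c.

(** The inner end of the layer in the scaled variable; profiles vanish there to
    order [n]. *)
Definition base_pt e : R := if e then -1 else 1.

(** The [k]-th power of [D] applied to [P((x - e) / c)]. *)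
Definition profile e c P k x : C :=
  ((c^-1) ^+ k)%:C%C * (iter k polyD P).[((x - e%:R) / c)%:C%C].

Lemma layer_sub01 e c x : 0 < c -> c <= 1 / 2 -> x \in layer_itv e c -> 0 <= x <= 1.
Proof.
by move=> c0 c1; case: e; rewrite /layer_itv in_itv/= => /andP[h1 h2]; apply/andP; split; lra.
Qed.

Lemma layer_inside e c x t : x \in layer_itv e c ->
  t \in `]Num.min (layer_base e c) x, Num.max (layer_base e c) x[ -> t \in layer_itv e c.
Proof.
case: e; rewrite /layer_itv /layer_base !in_itv/= => /andP[h1 h2].
  by rewrite min_l// max_r// => /andP[h3 h4]; apply/andP; split; lra.
by rewrite min_r// max_l// => /andP[h3 h4]; apply/andP; split; lra.
Qed.

Lemma layer_beyond e c x t : 0 <= x <= 1 -> x \notin layer_itv e c ->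
  t \in `]Num.min (layer_base e c) x, Num.max (layer_base e c) x[ -> t \notin layer_itv e c.
Proof.
move=> /andP[x0 x1]; case: e; rewrite /layer_itv /layer_base !in_itv/= ?x0 ?x1 ?andbT/= -ltNge => h.
  rewrite min_r ?(ltW h)// max_l ?(ltW h)// => /andP[h3 h4].
  by rewrite negb_and -!ltNge h4.
rewrite min_l ?(ltW h)// max_r ?(ltW h)// => /andP[h3 h4].
by rewrite negb_and -!ltNge h3 orbT.
Qed.

Lemma layer_scale e c x : 0 < c -> x \in layer_itv e c -> `|(x - e%:R) / c| <= 1.
Proof.
move=> c0; rewrite normrM normfV (gtr0_norm c0) ler_pdivrMr// mul1r ler_norml.
by case: e; rewrite in_itv/= => /andP[h1 h2]; apply/andP; split; lra.
Qed.

Lemma layer_base_scale e c : 0 < c -> (layer_base e c - e%:R) / c = base_pt e.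
Proof. by move=> c0; rewrite /layer_base /base_pt; case: e => /=; field; rewrite gt_eqF. Qed.

Lemma layer_end e c : 0 < c -> e%:R \in layer_itv e c.
Proof. by move=> c0; case: e; rewrite in_itv/=; apply/andP; split; lra. Qed.

Lemma layer_disjoint e c x : 0 < c -> c <= 1 / 4 -> x \in layer_itv e c ->
  x \notin layer_itv (~~ e) c.
Proof.
move=> c0 c1; case: e; rewrite !in_itv/= => /andP[h1 h2]; rewrite negb_and -!ltNge.
  by apply/orP; right; lra.
by apply/orP; left; lra.
Qed.

Lemma layer_itvE e c : layer_itv e c =
  Interval (BLeft (if e then 1 - c else 0)) (BRight (if e then 1 else c)).
Proof. by case: e. Qed.

Lemma cut_layer_cL1 e c (g : R -> C) (M : R) : cmeas g ->
  (forall x, x \in layer_itv e c -> nrm (g x) <= M) -> cL1 (cut (layer_itv e c) g).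
Proof. by rewrite layer_itvE => mg gM; apply: cut_bounded_cL1 gM. Qed.

Lemma cnorm1_layer e c : 0 < c -> cnorm1 (cut (layer_itv e c) (fun=> 1)) = c.
Proof.
move=> c0; rewrite /cnorm1.
have -> : im (cut (layer_itv e c) (fun=> 1)) = (fun=> 0) :> (R -> R).
  by apply/funext => t; rewrite /im /cut; case: ifP.
rewrite norm1_0 addr0 re_cut /norm1.
have -> : (fun t => `|((re (fun=> (1 : C))) \_ [set` layer_itv e c]) t|) =
    ((fun=> 1 : R) \_ [set` layer_itv e c]).
  by apply/funext => t; rewrite !patchE; case: ifP => _; rewrite ?normr1 ?normr0.
rewrite -Rintegral_mkcond Rintegral_cst// mul1r.
have mE : mu [set` layer_itv e c] = c%:E.
  rewrite layer_itvE lebesgue_measure_itv/= lte_fin; case: e => /=.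
    by rewrite ifT -?EFinB; [congr EFin; ring|lra].
  by rewrite c0 -EFinB subr0.
rewrite (_ : fine _ = fine (c%:E))//; congr fine; exact: mE.
Qed.

Lemma cnorm1_cut_layer e c (g : R -> C) (M : R) : 0 < c -> 0 <= M -> cmeas g ->
  (forall x, x \in layer_itv e c -> nrm (g x) <= M) ->
  cnorm1 (cut (layer_itv e c) g) <= 2 * M * c.
Proof.
move=> c0 M0 mg gM; rewrite -[X in _ * X](cnorm1_layer e c0).
rewrite (_ : cut _ g = (fun t => cut (layer_itv e c) (fun=> 1) t * cut (layer_itv e c) g t)).
  apply: cnorm1M; [|exact: cut_meas|].
    by apply: (cut_layer_cL1 (M := nrm 1)) => //; exact: cmeas_cst.
  by move=> t; rewrite /cut; case: ifP => [/gM//|_]; rewrite nrm0.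
by apply/funext => t; rewrite /cut; case: ifP; rewrite ?mul1r ?mul0r.
Qed.

Lemma profile_meas e c P k : cmeas (profile e c P k).
Proof. by apply: cmeasM; [exact: cmeas_cst|exact: poly_affine_meas]. Qed.

Lemma profile_bounded P k : exists2 M : R, 0 <= M & forall e c x, 0 < c ->
  x \in layer_itv e c -> nrm (profile e c P k x) <= c^-1 ^+ k * M.
Proof.
have [M M0 HM] := nrm_poly_bounded (iter k polyD P).
exists M => // e c x c0 xin; rewrite /profile nrmZ ger0_norm ?exprn_ge0 ?invr_ge0 ?(ltW c0)//.
rewrite ler_wpM2l ?exprn_ge0 ?invr_ge0 ?(ltW c0)//.
by apply: HM; exact: layer_scale.
Qed.

Lemma cut_profile_cL1 e c P k (z : C) : 0 < c ->
  cL1 (cut (layer_itv e c) (fun t => z * profile e c P k t)).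
Proof.
move=> c0; have [M M0 HM] := profile_bounded P k.
apply: (cut_layer_cL1 (M := nrm z * (c^-1 ^+ k * M))).
  by apply: cmeasM; [exact: cmeas_cst|exact: profile_meas].
move=> x xin; apply: (le_trans (nrmM _ _)).
by rewrite ler_wpM2l ?nrm_ge0// HM.
Qed.

(** The profile solves the system of the pure power [D ^ n] from zero data at the
    base of the layer, by its zero of order [n] there. *)
Lemma profile_primitive e c P k x : 0 < c ->
  (iter k polyD P).[(base_pt e)%:C%C] = 0 -> x \in layer_itv e c ->
  profile e c P k x =
    cintfrom (layer_base e c)
      (cut (layer_itv e c) (fun t => 'i%C * profile e c P k.+1 t)) x.
Proof.
move=> c0 P0 xin; rewrite (@cintfrom_poly _ ((c^-1 ^+ k.+1)%:C%C *: iter k polyD P) _ _ c e%:R).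
- rewrite !hornerZ layer_base_scale// P0 mulr0 subr0 mulrA; congr (_ * _).
  by rewrite -rmorphM exprS mulrA divff ?mul1r// gt_eqF.
- by rewrite gt_eqF.
- exact: cut_profile_cL1.
- move=> t tin; rewrite cut_in; last exact: layer_inside tin.
  rewrite /profile iterS /polyD derivZ !hornerZ mulrCA; congr (_ * _).
  by rewrite mulrA mulrN -expr2 sqr_i opprK mul1r.
Qed.

End Layers.

(** * Perturbation of a layer by the lower-order terms *)

Section LayerSolution.
Context {R : realType}.
Local Notation C := R[i].
Variables (n : nat) (p : 'I_n.-1 -> R -> C).
Hypothesis n_gt0 : (0 < n)%N.
Hypothesis hp : forall k, summable01 (p k).

(** Extended by zero from order [n - 1] on, so that all sums run over the same
    indices as the system. *)
Definition coef (j : nat) : R -> C :=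
  if insub j is Some j' then cut `]0, 1[ (p j') else fun=> 0.

Lemma coef_ord (j : 'I_n.-1) : coef j = cut `]0, 1[ (p j).
Proof. by rewrite /coef valK. Qed.

Lemma coef_ge j : (n.-1 <= j)%N -> coef j = fun=> 0.
Proof. by move=> nj; rewrite /coef insubF// ltnNge nj. Qed.

Lemma coef_int j : cL1 (coef j).
Proof. by rewrite /coef; case: insubP => [j' _ _|_]; [exact: coef_cL1|exact: cL10]. Qed.

Lemma lower_termsE Y t : lower_terms p Y t = \sum_(j < n) coef j t * Y j t.
Proof.
rewrite /lower_terms; under eq_bigr do rewrite -coef_ord.
rewrite (big_ord_widen n (fun j => coef j t * Y j t)) ?leq_pred// big_mkcond.
by apply: eq_bigr => j _; case: ltnP => // nj; rewrite coef_ge// mul0r.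
Qed.

Definition coef_norm : R := \sum_(j < n) cnorm1 (coef j).

Lemma cnorm1_ge0 (g : R -> C) : 0 <= cnorm1 g.
Proof. by rewrite addr_ge0// norm1_ge0. Qed.

Lemma coef_norm_ge0 : 0 <= coef_norm.
Proof. by apply: sumr_ge0 => j _; exact: cnorm1_ge0. Qed.

(** Up to this width the Volterra operator of the layer is a contraction. *)
Definition layer_size : R := Num.min (1 / 4) (1 / (16 * (coef_norm + 1))).

Lemma layer_size_gt0 : 0 < layer_size.
Proof.
have h := coef_norm_ge0; rewrite lt_min; apply/andP; split; first lra.
by rewrite divr_gt0// mulr_gt0//; lra.
Qed.

Lemma layer_size_le (c : R) : 0 < c -> c <= layer_size ->
  c <= 1 / 4 /\ 16 * coef_norm * c <= 1.
Proof.
have h := coef_norm_ge0; move=> c0; rewrite le_min => /andP[h1]; split => //.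
move: b; rewrite ler_pdivlMr; last by rewrite mulr_gt0//; lra.
by move=> h2; nra.
Qed.

(** The natural size of a [k]-th derivative in a layer of width [c]; the factor 4
    leaves room for the contraction by one half. *)
Definition weight (c : R) (k : nat) : R := (4 * c)^-1 ^+ k.

Lemma weight_ge0 c k : 0 < c -> 0 <= weight c k.
Proof. by move=> c0; rewrite exprn_ge0// invr_ge0 mulr_ge0// ltW. Qed.

Lemma weightS c k : 0 < c -> c * weight c k.+1 = weight c k / 4.
Proof. by move=> c0; rewrite /weight exprS; field; rewrite gt_eqF. Qed.

Lemma coef_weight c j : 0 < c -> c <= 1 / 4 -> 
  cnorm1 (coef j) * weight c j <= cnorm1 (coef j) * (4 * c * weight c n.-1).
Proof.
move=> c0 c4; have [nj|jn] := leqP n.-1 j.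
  by rewrite coef_ge// cnorm1_0 !mul0r.
rewrite ler_wpM2l ?cnorm1_ge0//.
have -> : 4 * c * weight c n.-1 = weight c n.-2.
  case: (n.-1) jn => // m _; rewrite /weight exprS mulrA divff ?mul1r// gt_eqF//.
  by rewrite mulr_gt0.
rewrite /weight ler_weXn2l// ?invr_ge1 ?unitfE ?gt_eqF ?mulr_gt0//; try lra.
by rewrite -ltnS (leq_trans jn)//; case: (n.-1) jn.
Qed.

Variables (e : bool) (P : {poly C}).
Hypothesis P0 : forall k, (k < n)%N -> (iter k polyD P).[(base_pt e : R)%:C%C] = 0.

Let raw c (Y : nat -> R -> C) k : R -> C :=
  cut (layer_itv e c) (fun t => 'i%C * (if (k.+1 < n)%N then Y k.+1 t
    else profile e c P n t - lower_terms p Y t)).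

(** The equation [l(y) = f] with zero Cauchy data at the base, as a Volterra
    equation. The principal part contracts because the layer is short, and the
    summable coefficients because they multiply derivatives of order at most
    [n - 2], which are smaller than the one of order [n - 1] by a factor [c]. *)
Lemma layer_fixpoint c (M : R) : 0 < c -> c <= layer_size -> 0 <= M ->
  (forall x, x \in layer_itv e c -> nrm (profile e c P n x) <= c^-1 ^+ n * M) ->
  exists Y : nat -> R -> C, [/\ forall k, cmeas (Y k),
    forall k, (n <= k)%N -> Y k = (fun=> 0),
    forall k x, nrm (Y k x) <= 8 * M * 4 ^+ n * weight c k &
    forall k x, (k < n)%N -> Y k x = cintfrom (layer_base e c) (raw c Y k) x].
Proof.
move=> c0 cl M0 HM; have [c4 cN] := layer_size_le c0 cl.
set S := layer_itv e c; set a := layer_base e c.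
pose A (k j : 'I_n) : R -> C := if (k.+1 < n)%N then
    (if j == k.+1 :> nat then cut S (fun=> 'i%C) else fun=> 0)
  else fun t => coef j t * cut S (fun=> - 'i%C) t.
pose b (k : 'I_n) : R -> C := if (k.+1 < n)%N then fun=> 0
  else cintfrom a (cut S (fun t => 'i%C * profile e c P n t)).
have ni : nrm ('i%C : C) = 1 by rewrite /nrm /= normr0 normr1 add0r.
have icut (z : C) : cL1 (cut S (fun=> z)).
  by apply: (cut_layer_cL1 (M := nrm z)) => //; exact: cmeas_cst.
have bcut t : nrm (cut S (fun=> - 'i%C) t) <= 1.
  by rewrite /cut; case: ifP => _; rewrite ?nrmN ?ni ?nrm0.
have mcut (z : C) : cmeas (cut S (fun=> z)) by exact/cut_meas/cmeas_cst.
have ib : cL1 (cut S (fun t => 'i%C * profile e c P n t)) by exact: cut_profile_cL1.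
have iA k j : cL1 (A k j).
  rewrite /A; case: ifP => _; last exact: cL1M (coef_int j) (mcut _) bcut.
  by case: ifP => _; [exact: icut|exact: cL10].
have [|||||| z [mz zK zE]] := @cvolterra R _ A b (fun k => weight c k) (2 * M * 4 ^+ n) a.
- exact: iA.
- move=> k; rewrite /b; case: ifP => _; first exact: cmeas_cst.
  exact: cintfrom_meas.
- by move=> k; exact: weight_ge0.
- by rewrite mulr_ge0// ?mulr_ge0// exprn_ge0.
- move=> k x; rewrite /b; case: ltnP => kn.
    by rewrite nrm0 mulr_ge0 ?weight_ge0// mulr_ge0 ?mulr_ge0 ?exprn_ge0.
  apply: (le_trans (cintfrom_le _ _ ib)).
  apply: (@le_trans _ _ (2 * (c^-1 ^+ n * M) * c)).
    apply: cnorm1_cut_layer => //.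
    + by rewrite mulr_ge0// exprn_ge0// invr_ge0 ltW.
    + by apply: cmeasM; [exact: cmeas_cst|exact: profile_meas].
    + by move=> t tin; rewrite nrm_iM HM.
  have kE : n = k.+1 by apply/eqP; rewrite eqn_leq kn ltn_ord.
  move: (nat_of_ord k) kE => l kE.
  rewrite /weight kE !exprS invfM exprMn.
  have h4 : 4 ^+ l != 0 :> R by rewrite expf_neq0.
  have -> : 2 * (c^-1 * c^-1 ^+ l * M) * c = 2 * M * c^-1 ^+ l.
    by field; rewrite gt_eqF.
  rewrite [4^-1 ^+ l]exprVn.
  have -> : 2 * M * (4 * 4 ^+ l) * (4 ^- l * c^-1 ^+ l) = 8 * M * c^-1 ^+ l.
    by field.
  rewrite ler_wpM2r ?exprn_ge0 ?invr_ge0 ?(ltW c0)//; lra.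
- move=> k; have [kn|nk] := ltnP k.+1 n.
    rewrite (bigD1 (Ordinal kn))//= big1 ?addr0; last first.
      move=> j jk; rewrite /A kn ifF; first by rewrite cnorm1_0 mul0r.
      by apply: contraNF jk => /eqP jE; apply/eqP/val_inj.
    rewrite /A kn eqxx.
    apply: (@le_trans _ _ (2 * 1 * c * weight c k.+1)).
      rewrite ler_wpM2r ?weight_ge0//; apply: cnorm1_cut_layer => //.
        exact: cmeas_cst.
      by move=> x _; rewrite ni.
    by rewrite -[leLHS]mulrA weightS//; have := weight_ge0 k c0; lra.
  apply: (@le_trans _ _ (\sum_(j < n) 2 * (cnorm1 (coef j) * (4 * c * weight c n.-1)))).
    apply: ler_sum => j _; rewrite /A ltnNge nk /=.
    apply: (le_trans _ (_ : 2 * (cnorm1 (coef j) * weight c j) <= _)); last first.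
      by rewrite ler_wpM2l// coef_weight.
    rewrite mulrA ler_wpM2r ?weight_ge0//.
    by have := cnorm1M (coef_int j) (mcut _) bcut; rewrite mulr1.
  rewrite -mulr_sumr -mulr_suml -/coef_norm.
  have -> : nat_of_ord k = n.-1.
    by apply/eqP; rewrite -eqSS prednK// eqn_leq nk ltn_ord.
  have := weight_ge0 n.-1 c0; set w := weight _ _ => w0; nra.
pose Y k : R -> C := if insub k is Some k' then z k' else fun=> 0.
have Yz (k : 'I_n) : Y k = z k by rewrite /Y valK.
exists Y; split.
- by move=> k; rewrite /Y; case: insubP => [k' _ _|_]; [exact: mz|exact: cmeas_cst].
- by move=> k nk; rewrite /Y insubF// ltnNge nk.
- move=> k x; rewrite /Y; case: insubP => [k' _ <-|_].
    by rewrite (le_trans (zK k' x))// le_eqVlt; apply/orP; left; apply/eqP; ring.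
  by rewrite nrm0 mulr_ge0 ?weight_ge0// mulr_ge0 ?mulr_ge0 ?exprn_ge0.
move=> k x kn; rewrite -[k]/(nat_of_ord (Ordinal kn)) Yz zE /raw /b /A /=.
have [kn1|nk] := ltnP k.+1 n.
  rewrite add0r; congr cintfrom; apply/funext => t.
  rewrite (bigD1 (Ordinal kn1))//= eqxx big1 ?addr0; last first.
    move=> j jk; rewrite ifF ?mul0r//.
    by apply: contraNF jk => /eqP jE; apply/eqP/val_inj.
  by rewrite -Yz /= /cut; case: ifP => //; rewrite mul0r.
rewrite -cintfromD//.
  congr cintfrom; apply/funext => t.
  rewrite (eq_bigr (fun j : 'I_n => (coef j t * Y j t) * cut S (fun=> - 'i%C) t)).
    by rewrite -mulr_suml /cut -/S; case: ifP => _; rewrite ?mulr0 ?addr0// -lower_termsE; ring.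
  by move=> j _; rewrite Yz mulrAC.
apply: cL1_sum => j; apply: cL1M (mz j) (zK j).
exact: cL1M (coef_int j) (mcut _) bcut.
Qed.

Lemma raw_cL1 c (Y : nat -> R -> C) k (M' : R) : 0 < c -> (forall k, cmeas (Y k)) ->
  (forall k x, nrm (Y k x) <= M') -> cL1 (raw c Y k).
Proof.
move=> c0 mY YM; rewrite /raw; case: ltnP => kn.
  apply: (cut_layer_cL1 (M := nrm 'i%C * M')).
    by apply: cmeasM => //; exact: cmeas_cst.
  by move=> x _; rewrite (le_trans (nrmM _ _))// ler_wpM2l ?nrm_ge0.
have il := lower_terms_cL1 hp mY YM.
rewrite (_ : cut _ _ = fun t => cut (layer_itv e c) (fun t => 'i%C * profile e c P n t) t +
   lower_terms p Y t * cut (layer_itv e c) (fun=> - 'i%C) t).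
  apply: cL1D; first exact: cut_profile_cL1.
  apply: (cL1M (M := nrm (- 'i%C)) il); first exact/cut_meas/cmeas_cst.
  by move=> t; rewrite /cut; case: ifP; rewrite ?nrm0 ?nrm_ge0.
by apply/funext => t; rewrite /cut; case: ifP => _; [ring|rewrite mulr0 addr0].
Qed.

(** Nothing propagates past the base, since the right-hand side is supported in
    the layer. *)
Lemma layer_vanish c (Y : nat -> R -> C) (M' : R) k x : 0 < c -> (forall k, cmeas (Y k)) ->
  (forall k x, nrm (Y k x) <= M') ->
  Y k x = cintfrom (layer_base e c) (raw c Y k) x ->
  0 <= x <= 1 -> x \notin layer_itv e c -> Y k x = 0.
Proof.
move=> c0 mY YM -> x01 xS.
rewrite (@eq_cintfrom _ _ _ _ (fun=> 0)).
- by rewrite /cintfrom /re /im /= intfrom0.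
- exact: raw_cL1 YM.
- exact: cL10.
- by move=> t tin; rewrite /raw cut_out//; exact: layer_beyond tin.
Qed.

Lemma layer_slope c (Y : nat -> R -> C) k : 0 < c -> c <= 1 / 2 ->
  (forall k x, (k < n)%N -> 0 <= x <= 1 -> x \notin layer_itv e c -> Y k x = 0) ->
  slope p Y (cut (layer_itv e c) (profile e c P n)) k = raw c Y k.
Proof.
move=> c0 c2 Y0; apply/funext => t; rewrite /slope /raw.
have [tS|tS] := boolP (t \in layer_itv e c).
  rewrite [RHS]cut_in// cut_in; last by have := layer_sub01 c0 c2 tS; rewrite in_itv.
  by rewrite [cut _ (profile _ _ _ _) _]cut_in.
rewrite [RHS]cut_out//; have [t01|t01] := boolP (t \in `[0, 1]); last by rewrite cut_out.
have t01' : 0 <= t <= 1 by rewrite in_itv/= in t01.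
rewrite cut_in//; case: ltnP => kn; first by rewrite Y0// mulr0.
rewrite cut_out// sub0r lower_termsE big1 ?oppr0 ?mulr0// => j _.
by rewrite Y0// mulr0.
Qed.

Lemma cnorm1_lower c (Y : nat -> R -> C) (K : R) : 0 < c -> c <= 1 / 4 -> 0 <= K ->
  (forall k, cmeas (Y k)) -> (forall k x, nrm (Y k x) <= K * weight c k) ->
  cnorm1 (lower_terms p Y) <= 8 * K * coef_norm * c * c^-1 ^+ n.-1.
Proof.
move=> c0 c4 K0 mY YK.
rewrite (_ : lower_terms p Y = fun t => \sum_(j < n) coef j t * Y j t); last first.
  by apply/funext => t; rewrite lower_termsE.
have iF (j : 'I_n) : cL1 (fun t => coef j t * Y j t) := cL1M (coef_int j) (mY j) (YK j).
apply: (le_trans (cnorm1_sum _ iF)).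
apply: (@le_trans _ _ (\sum_(j < n) 2 * K * (cnorm1 (coef j) * (4 * c * weight c n.-1)))).
  apply: ler_sum => j _; apply: (le_trans (cnorm1M (coef_int j) (mY j) (YK j))).
  have := coef_weight j c0 c4; have := cnorm1_ge0 (coef j); have := weight_ge0 j c0.
  set u := cnorm1 _; set w := weight c j; set w' := weight c _ => w0 u0 h; nra.
rewrite -mulr_sumr -mulr_suml -/coef_norm.
have -> : 2 * K * (coef_norm * (4 * c * weight c n.-1)) =
  8 * K * coef_norm * c * weight c n.-1 by ring.
have w1 : weight c n.-1 <= c^-1 ^+ n.-1.
  rewrite /weight lerXn2r ?nnegrE ?invr_ge0 ?mulr_ge0 ?(ltW c0)//.
  by rewrite lef_pV2 ?posrE ?mulr_gt0//; lra.
by rewrite ler_wpM2l// !mulr_ge0 ?coef_norm_ge0// ltW.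
Qed.

(** As [l] has no term of order [n - 1], the lower-order terms perturb every
    derivative of the profile by a relative amount of order [c]. *)
Lemma layer_solution : exists B : R, forall c, 0 < c -> c <= layer_size ->
  exists Y : nat -> R -> C,
  [/\ qsol p Y (cut (layer_itv e c) (profile e c P n)),
    forall k x, (k < n)%N -> 0 <= x <= 1 -> x \notin layer_itv e c -> Y k x = 0 &
    forall k x, (k < n)%N -> x \in layer_itv e c ->
      nrm (Y k x - profile e c P k x) <= B * c * c^-1 ^+ k].
Proof.
have [M M0 HM] := profile_bounded P n.
pose K := 8 * M * 4 ^+ n.
have K0 : 0 <= K by rewrite !mulr_ge0 ?exprn_ge0.
pose D := 16 * K * coef_norm.
have D0 : 0 <= D by rewrite !mulr_ge0// coef_norm_ge0.
exists (2 ^+ n * D) => c c0 cl; have [c4 cN] := layer_size_le c0 cl.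
have c2 : c <= 1 / 2 by lra.
have [Y [mY Yn YK Yeq]] := layer_fixpoint c0 cl M0 (fun x => HM e c x c0).
have [M' YM] : exists M', forall k x, nrm (Y k x) <= M'.
  exists (\sum_(k < n) K * weight c k) => k x.
  have s0 (j : 'I_n) : 0 <= K * weight c j by rewrite mulr_ge0// weight_ge0.
  case: (ltnP k n) => kn; last by rewrite Yn// nrm0 sumr_ge0.
  by rewrite (le_trans (YK k x))// (bigD1 (Ordinal kn))//= lerDl sumr_ge0.
have Yout k x : (k < n)%N -> 0 <= x <= 1 -> x \notin layer_itv e c -> Y k x = 0.
  by move=> kn; apply: layer_vanish YM _ => //; exact: Yeq.
have ci0 k : 0 <= c^-1 ^+ k by rewrite exprn_ge0// invr_ge0 ltW.
exists Y; split => //.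
- split => //.
  + by exists M'.
  + exact/cut_meas/profile_meas.
  + exists (c^-1 ^+ n * M) => x; rewrite /cut; case: ifP => xS; first exact: HM.
    by rewrite nrm0 mulr_ge0.
  + move=> k x kn x01; rewrite !Yeq// (layer_slope _ c0 c2 Yout).
    by rewrite (cintfrom_add _ 0).
(* downward induction on the order of the derivative *)
have key m k x : (k + m = n.-1)%N -> x \in layer_itv e c ->
    nrm (Y k x - profile e c P k x) <= 2 ^+ m * D * c * c^-1 ^+ k.
  elim: m k x => [|m IH] k x km xS.
    rewrite addn0 in km; have kn : (k < n)%N by rewrite km prednK.
    have kn' : (k.+1 < n)%N = false by rewrite km prednK// ltnn.
    rewrite Yeq// (profile_primitive c0 (P0 kn) xS).
    rewrite -mulN1r -cintfromZ; last exact: cut_profile_cL1.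
    rewrite -cintfromD; [|exact: raw_cL1 YM|by apply: cL1Z; exact: cut_profile_cL1].
    have kE : k.+1 = n by rewrite km prednK.
    have il := lower_terms_cL1 hp mY YM.
    have mc : cmeas (cut (layer_itv e c) (fun=> - 'i%C : C)) by exact/cut_meas/cmeas_cst.
    have bc t : nrm (cut (layer_itv e c) (fun=> - 'i%C) t : C) <= 1.
      by rewrite /cut; case: ifP => _; rewrite ?nrmN ?nrm0// /nrm /= normr0 normr1 add0r.
    rewrite (_ : (fun t => _) = fun t => lower_terms p Y t *
       cut (layer_itv e c) (fun=> - 'i%C) t); last first.
      apply/funext => t; rewrite /raw kn' kE /cut; case: ifP => _; last first.
        by rewrite !mulr0 addr0.
      ring.
    apply: (le_trans (cintfrom_le _ _ (cL1M il mc bc))).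
    apply: (le_trans (cnorm1M il mc bc)); rewrite mulr1 expr0 mul1r km.
    apply: (le_trans (ler_wpM2l _ (cnorm1_lower c0 c4 K0 mY YK))) => //.
    by rewrite le_eqVlt /D; apply/orP; left; apply/eqP; ring.
  have kn1 : (k.+1 < n)%N by rewrite -ltn_predRL -km addnS ltnS leq_addr.
  have kn : (k < n)%N by exact: ltnW.
  rewrite Yeq// (profile_primitive c0 (P0 kn) xS).
  rewrite -mulN1r -cintfromZ; last exact: cut_profile_cL1.
  rewrite -cintfromD; [|exact: raw_cL1 YM|by apply: cL1Z; exact: cut_profile_cL1].
  rewrite (_ : (fun t => _) = cut (layer_itv e c)
     (fun t => 'i%C * (Y k.+1 t - profile e c P k.+1 t))); last first.
    apply/funext => t; rewrite /raw kn1 /cut; case: ifP => _; last first.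
      by rewrite mulr0 addr0.
    ring.
  have mg : cmeas (fun t => 'i%C * (Y k.+1 t - profile e c P k.+1 t)).
    apply: cmeasM; first exact: cmeas_cst.
    by apply: cmeasD => //; apply: cmeasN; exact: profile_meas.
  have bg t : t \in layer_itv e c ->
      nrm ('i%C * (Y k.+1 t - profile e c P k.+1 t)) <= 2 ^+ m * D * c * c^-1 ^+ k.+1.
    by move=> tS; rewrite nrm_iM IH// addSnnS.
  apply: (le_trans (cintfrom_le _ _ (cut_layer_cL1 mg bg))).
  have b0 : 0 <= 2 ^+ m * D * c * c^-1 ^+ k.+1.
    by rewrite mulr_ge0// mulr_ge0 ?(ltW c0)// mulr_ge0// exprn_ge0.
  apply: (le_trans (cnorm1_cut_layer c0 b0 mg bg)).
  rewrite le_eqVlt; apply/orP; left; apply/eqP; rewrite !exprS; field.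
  by rewrite gt_eqF.
move=> k x kn xS; have km : (k + (n.-1 - k) = n.-1)%N.
  by rewrite subnKC// -ltnS prednK.
apply: (le_trans (key _ k x km xS)).
rewrite ler_wpM2r// ler_wpM2r ?(ltW c0)// ler_wpM2r//.
by rewrite ler_weXn2l ?ler1n// (leq_trans (leq_subr _ _))// leq_pred.
Qed.

End LayerSolution.

(** * Green's formula for polynomial profiles *)

Section PolynomialGreen.
Context {R : realType}.
Local Notation C := R[i].
Implicit Types (P Q G H : {poly C}).

Definition antider G : {poly C} := \poly_(i < (size G).+1) (G`_i.-1 / i%:R).

Lemma coef_antider G i : (antider G)`_i = G`_i.-1 / i%:R.
Proof.
rewrite coef_poly; case: ltnP => // h.
by rewrite nth_default ?mul0r// -ltnS prednK// (leq_ltn_trans _ h).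
Qed.

Lemma antiderK G : (antider G)^`() = G.
Proof.
apply/polyP => i.
by rewrite coef_deriv coef_antider/= -[LHS]mulr_natr -mulrA mulVf ?mulr1 ?pnatr_eq0.
Qed.

Lemma antider_deriv H : antider H^`() = H - (H.[0])%:P.
Proof.
apply/polyP => i; rewrite coef_antider coefB coefC horner_coef0.
case: i => [|i]; first by rewrite invr0 mulr0 subrr.
by rewrite coef_deriv /= subr0 -[_ *+ i.+1 in LHS]mulr_natr mulfK// pnatr_eq0.
Qed.

(** The integral of a polynomial over the scaled layer, [0, 1] at the left end
    point and [-1, 0] at the right one. *)
Definition pint (e : bool) G : C :=
  (base_pt e)%:C%C * (antider G).[(base_pt e)%:C%C].

Lemma pint_lin (e : bool) (I : Type) (s : seq I) (w : I -> C) (F : I -> {poly C}) :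
  pint e (\sum_(i <- s) w i *: F i) = \sum_(i <- s) w i * pint e (F i).
Proof.
rewrite /pint; have -> : antider (\sum_(i <- s) w i *: F i) = \sum_(i <- s) w i *: antider (F i).
  apply/polyP => j; rewrite coef_antider !coef_sum mulr_suml; apply: eq_bigr => i _.
  by rewrite !coefZ coef_antider mulrA.
rewrite horner_sum mulr_sumr; apply: eq_bigr => i _.
by rewrite hornerZ mulrCA.
Qed.

Lemma pintB e G H : pint e (G - H) = pint e G - pint e H.
Proof.
have := pint_lin e [:: true; false] (fun b => if b then 1 else -1) (fun b => if b then G else H).
by rewrite !big_cons !big_nil !addr0 scale1r scaleN1r mul1r mulN1r.
Qed.

Lemma pint_deriv e H : pint e H^`() =
  (base_pt e)%:C%C * (H.[(base_pt e)%:C%C] - H.[0]).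
Proof. by rewrite /pint antider_deriv hornerD hornerN hornerC. Qed.

Definition polyJ P : {poly C} := map_poly (@conjc R) P.

Lemma polyJ_real P (t : R) : (polyJ P).[t%:C%C] = (P.[t%:C%C])^*%C.
Proof. by rewrite /polyJ -{1}(conjc_real t) horner_map. Qed.

Lemma polyJ_deriv P : polyJ P^`() = (polyJ P)^`().
Proof. by rewrite /polyJ deriv_map. Qed.

Lemma antiderJ G : antider (polyJ G) = polyJ (antider G).
Proof.
apply/polyP => i; rewrite coef_antider !coef_map coef_antider /=.
by rewrite rmorphM fmorphV rmorph_nat.
Qed.

Lemma pintJ e G : pint e (polyJ G) = (pint e G)^*%C.
Proof. by rewrite /pint antiderJ polyJ_real rmorphM /= oppr0. Qed.

Lemma polyJK P : polyJ (polyJ P) = P.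
Proof. by apply/polyP => i; rewrite !coef_map /= conjcK. Qed.

Lemma polyJM P Q : polyJ (P * Q) = polyJ P * polyJ Q.
Proof. exact: rmorphM. Qed.

(** Lagrange's identity is the telescoping sum of these. *)
Lemma polyD_parts P Q : polyD P * polyJ Q - P * polyJ (polyD Q) =
  (- 'i%C) *: (P * polyJ Q)^`().
Proof.
rewrite derivM -polyJ_deriv /polyD {2}/polyJ map_polyZ /= scalerDr.
rewrite -!scalerAl -scalerAr -/(polyJ _); congr (_ + _).
by rewrite -scaleNr; congr (_ *: _); apply: complexP; rewrite /= ?oppr0 ?opprK.
Qed.

Definition bilinear_concomitant n P : {poly C} :=
  \sum_(k < n) iter (n.-1 - k) polyD P * polyJ (iter k polyD P).

Lemma lagrange_identity n P :
  iter n polyD P * polyJ P - P * polyJ (iter n polyD P) =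
  (- 'i%C) *: (bilinear_concomitant n P)^`().
Proof.
rewrite /bilinear_concomitant raddf_sum /= scaler_sumr.
transitivity (\sum_(k < n) (iter (n - k) polyD P * polyJ (iter k polyD P) -
   iter (n - k.+1) polyD P * polyJ (iter k.+1 polyD P))).
  rewrite -(big_mkord xpredT (fun k => iter (n - k) polyD P * polyJ (iter k polyD P) -
    iter (n - k.+1) polyD P * polyJ (iter k.+1 polyD P))).
  under eq_bigr do rewrite -opprB.
  rewrite sumrN (telescope_sumr (fun k => iter (n - k) polyD P * polyJ (iter k polyD P)))//.
  by rewrite subnn subn0 opprB.
apply: eq_bigr => k _; rewrite -polyD_parts -iterS; congr (iter _ _ _ * _ - iter _ _ _ * _).
  by have := ltn_ord k; lia.
by have := ltn_ord k; lia.
Qed.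

(** Green's formula on a layer, for a profile vanishing to order [n] at the
    inner end: only the contribution of the end point of the interval remains. *)
Lemma pint_green e n P :
  (forall k, (k < n)%N -> (iter k polyD P).[(base_pt e)%:C%C] = 0) ->
  pint e (iter n polyD P * polyJ P) - (pint e (iter n polyD P * polyJ P))^*%C =
  (base_pt e)%:C%C * 'i%C *
   \sum_(k < n) (iter (n.-1 - k) polyD P).[0] * ((iter k polyD P).[0])^*%C.
Proof.
move=> P0; rewrite -pintJ.
have -> : polyJ (iter n polyD P * polyJ P) = P * polyJ (iter n polyD P).
  by rewrite polyJM polyJK mulrC.
rewrite -pintB lagrange_identity.
rewrite -derivZ pint_deriv -mulrA; congr (_ * _).
rewrite !hornerZ /bilinear_concomitant !horner_sum.
rewrite [X in _ * X - _]big1 ?mulr0 ?sub0r; last first.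
  by move=> k _; rewrite hornerM P0 ?mul0r//; have := ltn_ord k; lia.
rewrite -mulNr opprK; congr (_ * _); apply: eq_bigr => k _.
by rewrite hornerM -[X in (polyJ _).[X]](_ : (0 : R)%:C%C = 0)// polyJ_real.
Qed.

Lemma iter_polyD k P : iter k polyD P = (- 'i%C) ^+ k *: P^`(k).
Proof.
elim: k => [|k IH]; first by rewrite expr0 scale1r derivn0.
by rewrite iterS IH /polyD derivZ scalerA derivnS exprS.
Qed.

Lemma iter_polyD0 k P : (iter k polyD P).[0] = (- 'i%C) ^+ k * (k`!%:R * P`_k).
Proof.
rewrite iter_polyD hornerZ horner_coef0 coef_derivn addn0 ffactnn.
by rewrite mulr_natl.
Qed.

Lemma iter_polyD_root k m (b : C) P : (k < m)%N -> ('X - b%:P) ^+ m %| P ->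
  (iter k polyD P).[b] = 0.
Proof.
move=> km /dvdpP[A ->] {P}.
have [B ->] : exists B, iter k polyD (A * ('X - b%:P) ^+ m) = B * ('X - b%:P) ^+ (m - k).
  elim: k km => [|k IH] km; first by exists A; rewrite subn0.
  have [B EB] := IH (ltnW km).
  exists ((- 'i%C) *: (B^`() * ('X - b%:P) + B *+ (m - k)%N)).
  rewrite iterS EB /polyD derivM deriv_exp derivXsubC mul1r -scalerAl; congr (_ *: _).
  move: (m - k.+1)%N (subnSK (ltnW km)) => l <-.
  by rewrite /= mulrDl exprS mulrA mulrnAr mulrnAl.
by rewrite hornerM horner_exp hornerXsubC subrr expr0n subn_eq0 leqNgt km mulr0.
Qed.

End PolynomialGreen.

(** * Elementary jets and limits of thin layers *)

Section JetsAndIntegrals.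
Context {R : realType}.
Local Notation C := R[i].

(** The conditions at [0] and at the inner end are independent by the Chinese
    remainder theorem. *)
Lemma jet_poly (e : bool) n i : (i < n)%N -> exists P : {poly C},
  (forall k, (k < n)%N -> (iter k polyD P).[(base_pt e : R)%:C%C] = 0) /\
  (forall k, (k < n)%N -> (iter k polyD P).[0] = (k == i)%:R).
Proof.
move=> ni; set b : C := (base_pt e : R)%:C%C.
have b0 : b != 0.
  rewrite /b /base_pt; case: (e); rewrite ?rmorphN rmorph1 ?oppr_eq0 oner_eq0//.
have cop : coprimep ('X^n : {poly C}) (('X - b%:P) ^+ n).
  rewrite coprimep_expl// coprimep_expr//.
  by rewrite coprimep_XsubC rootX.
have [[u v] /= uv] := Bezout_eq1_coprimepP _ _ cop.
pose kap : C := 'i%C ^+ i / i`!%:R.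
exists (kap *: ('X^i * (v * ('X - b%:P) ^+ n))); split => k kn.
  apply: (iter_polyD_root kn); rewrite dvdpZr ?dvdp_mull//.
  rewrite mulf_neq0// ?invr_eq0 ?pnatr_eq0 -?lt0n ?fact_gt0// expf_neq0//.
  by rewrite eq_complex /= eqxx oner_eq0.
have -> : v * ('X - b%:P) ^+ n = 1 - u * 'X^n by rewrite -uv addrAC subrr add0r.
rewrite iter_polyD0 coefZ mulrBr mulr1 coefB (mulrCA 'X^i) -exprD coefMXn.
rewrite (leq_trans kn) ?leq_addl// subr0 coefXn.
have [->|ki] := eqVneq k i; last by rewrite !mulr0.
rewrite mulr1 /kap [_%:R * _]mulrC mulfVK ?pnatr_eq0 -?lt0n ?fact_gt0//.
by rewrite -exprMn mulNr -expr2 sqr_i opprK expr1n.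
Qed.

Lemma integral01E (g : R -> C) : cL1 g -> integral01 g = cintfrom 0 g 1.
Proof.
move=> [rg ig]; rewrite /integral01 /cintfrom /intfrom !prim_itv//.
by rewrite -!Rintegral_itv_bndo_bndc//; exact: L1S.
Qed.

Lemma cintfrom_layer_beyond (e : bool) (c x : R) (g : R -> C) : 0 <= x <= 1 ->
  x \notin layer_itv e c -> cL1 (cut (layer_itv e c) g) ->
  cintfrom (layer_base e c) (cut (layer_itv e c) g) x = 0.
Proof.
move=> x01 xS ig; rewrite (@eq_cintfrom _ _ _ _ (fun=> 0)) //.
- by rewrite /cintfrom /re /im /= intfrom0.
- exact: cL10.
- by move=> t tin; rewrite cut_out//; exact: layer_beyond tin.
Qed.

Lemma cintfrom_swap (a b : R) (g : R -> C) : cintfrom a g b = - cintfrom b g a.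
Proof. by apply: complexP; rewrite ?ReN ?ImN /= /intfrom opprB. Qed.

Lemma integral01_layer (e : bool) (c : R) (G : {poly C}) : 0 < c -> c <= 1 / 4 ->
  integral01 (cut (layer_itv e c) (fun t => G.[((t - e%:R) / c)%:C%C])) =
  c%:C%C * pint e G.
Proof.
move=> c0 c4; set S := layer_itv e c; set g := cut _ _.
have ig : cL1 g.
  have [M M0 HM] := nrm_poly_bounded G.
  apply: (cut_layer_cL1 (M := M)); first exact: poly_affine_meas.
  by move=> x xS; apply: HM; exact: layer_scale.
rewrite integral01E// (cintfrom_add 0 (layer_base e c)).
have FTC x : x \in S -> cintfrom (layer_base e c) g x =
    c%:C%C * ((antider G).[((x - e%:R) / c)%:C%C] - (antider G).[(base_pt e)%:C%C]).
  move=> xS; rewrite -[in RHS](layer_base_scale e c0); apply: cintfrom_poly => //.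
    by rewrite gt_eqF.
  by move=> t tin; rewrite /g cut_in ?antiderK//; exact: layer_inside tin.
have A0 : (antider G).[0] = 0 by rewrite horner_coef0 coef_antider invr0 mulr0.
have out : (0 <= (~~ e)%:R :> R) && ((~~ e)%:R <= 1 :> R).
  by case: (e) => /=; rewrite ?lexx ?ler01.
have outS : (~~ e)%:R \notin S.
  by have := layer_disjoint c0 c4 (layer_end (~~ e) c0); rewrite negbK.
have z := cintfrom_layer_beyond out outS ig.
have i := FTC _ (layer_end e c0); rewrite subrr mul0r A0 in i.
rewrite cintfrom_swap /pint; move: z i; rewrite -/g; case: (e) => /= -> ->.
  by rewrite oppr0 add0r sub0r rmorphN rmorph1; ring.
by rewrite addr0 sub0r rmorph1; ring.
Qed.

End JetsAndIntegrals.

Section Approximation.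
Context {R : realType}.
Local Notation C := R[i].
Variable c0 : R.
Hypothesis c0_gt0 : 0 < c0.
Hypothesis c0_le1 : c0 <= 1.
Implicit Types (a b : R -> C) (l m : C).

(** Convergence at a linear rate as the width of the layer shrinks; this avoids
    any topology on matrices of complex numbers. *)
Definition approx a l := exists K : R, forall c, 0 < c -> c <= c0 ->
  nrm (a c - l) <= K * c.

Lemma approx_eq a b l : (forall c, 0 < c -> c <= c0 -> a c = b c) ->
  approx a l -> approx b l.
Proof. by move=> ab [K HK]; exists K => c h1 h2; rewrite -ab// HK. Qed.

Lemma approx_cst l : approx (fun=> l) l.
Proof. by exists 0 => c _ _; rewrite subrr nrm0 mul0r. Qed.

Lemma approxD a b l m : approx a l -> approx b m -> approx (fun c => a c + b c) (l + m).
Proof.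
move=> [K HK] [L HL]; exists (K + L) => c h1 h2.
by rewrite opprD addrACA (le_trans (nrmD _ _))// mulrDl lerD ?HK ?HL.
Qed.

Lemma approxM a b l m : approx a l -> approx b m -> approx (fun c => a c * b c) (l * m).
Proof.
move=> [K HK] [L HL].
exists (`|K| * (`|L| + nrm m) + nrm l * `|L|) => c h1 h2.
have -> : a c * b c - l * m = (a c - l) * b c + l * (b c - m) by ring.
have hK : nrm (a c - l) <= `|K| * c by rewrite (le_trans (HK c h1 h2))// ler_wpM2r ?ler_norm// ltW.
have hL : nrm (b c - m) <= `|L| * c by rewrite (le_trans (HL c h1 h2))// ler_wpM2r ?ler_norm// ltW.
have hb : nrm (b c) <= `|L| + nrm m.
  rewrite -[b c](subrK m) (le_trans (nrmD _ _))// lerD2r (le_trans hL)// ler_piMr//.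
  exact: le_trans h2 c0_le1.
rewrite (le_trans (nrmD _ _))// [leRHS]mulrDl lerD//.
  rewrite (le_trans (nrmM _ _))// mulrAC ler_pM ?nrm_ge0//.
by rewrite (le_trans (nrmM _ _))// -mulrA ler_wpM2l ?nrm_ge0.
Qed.

Lemma approxZ z a l : approx a l -> approx (fun c => z * a c) (z * l).
Proof. by apply: approxM; exact: approx_cst. Qed.

Lemma approxJ a l : approx a l -> approx (fun c => (a c)^*%C) (l^*)%C.
Proof.
by move=> [K HK]; exists K => c h1 h2; rewrite -rmorphB nrmJ HK.
Qed.

Lemma approx_sum (I : Type) (s : seq I) (F : I -> R -> C) (l : I -> C) :
  (forall i, approx (F i) (l i)) ->
  approx (fun c => \sum_(i <- s) F i c) (\sum_(i <- s) l i).
Proof.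
move=> HF; elim: s => [|i s IH].
  by rewrite big_nil; apply: approx_eq (approx_cst 0) => c _ _; rewrite big_nil.
rewrite big_cons; apply: approx_eq (approxD (HF i) IH) => c _ _.
by rewrite big_cons.
Qed.

Lemma approx_prod (I : Type) (s : seq I) (F : I -> R -> C) (l : I -> C) :
  (forall i, approx (F i) (l i)) ->
  approx (fun c => \prod_(i <- s) F i c) (\prod_(i <- s) l i).
Proof.
move=> HF; elim: s => [|i s IH].
  by rewrite big_nil; apply: approx_eq (approx_cst 1) => c _ _; rewrite big_nil.
rewrite big_cons; apply: approx_eq (approxM (HF i) IH) => c _ _.
by rewrite big_cons.
Qed.

Lemma approx_det n (A : R -> 'M[C]_n) (B : 'M[C]_n) :
  (forall i j, approx (fun c => A c i j) (B i j)) ->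
  approx (fun c => \det (A c)) (\det B).
Proof.
move=> AB; rewrite /determinant; apply: approx_sum => s; apply: approxZ.
by apply: approx_prod => i; exact: AB.
Qed.

Lemma approx_adj n (A : R -> 'M[C]_n) (B : 'M[C]_n) :
  (forall i j, approx (fun c => A c i j) (B i j)) ->
  forall i j, approx (fun c => (\adj (A c)) i j) ((\adj B) i j).
Proof.
move=> AB i j; rewrite mxE /cofactor.
apply: approx_eq (approxZ _ (approx_det (A := fun c => row' j (col' i (A c))) _)).
  by move=> c _ _; rewrite mxE.
by move=> k l; rewrite !mxE; apply: approx_eq (AB _ _) => c _ _; rewrite !mxE.
Qed.

Lemma approx_small k z a l : approx a l ->
  approx (fun c => (c ^+ k.+1)%:C%C * a c * z) 0.
Proof.
move=> al; rewrite -(mul0r z); apply: approxM; last exact: approx_cst.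
rewrite -(mul0r l); apply: approxM => //.
exists 1 => c h1 h2; rewrite subr0 -[X in nrm X]mulr1 nrmZ.
rewrite ger0_norm ?exprn_ge0 ?(ltW h1)// /nrm /= normr1 normr0 addr0 mulr1 mul1r.
by rewrite exprS ler_piMr ?(ltW h1)// exprn_ile1// ?(ltW h1)// (le_trans h2).
Qed.

Lemma approx_Im_ge0 a l : approx a l ->
  (forall c, 0 < c -> c <= c0 -> 0 <= complex.Im (a c)) -> 0 <= complex.Im l.
Proof.
move=> [K HK] Ha; rewrite leNgt; apply/negP => l0.
have hc c : 0 < c -> c <= c0 -> - complex.Im l <= K * c.
  move=> h1 h2; have := HK c h1 h2; have := Ha c h1 h2.
  have := nrm_Im (a c - l); rewrite ImD ImN ler_norml => /andP[_].
  lra.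
pose d := Num.min c0 (- complex.Im l / (2 * (`|K| + 1))).
have K1 : 0 < 2 * (`|K| + 1) by rewrite mulr_gt0// ltr_wpDl.
have d0 : 0 < d by rewrite lt_min c0_gt0 divr_gt0// oppr_gt0.
have dle : d <= c0 by rewrite ge_min lexx.
have d2 : d * (2 * (`|K| + 1)) <= - complex.Im l by rewrite -ler_pdivlMr// ge_min lexx orbT.
have := hc d d0 dle; have := ler_norm K; have := normr_ge0 K; nra.
Qed.

End Approximation.

(** * Families of boundary layers *)

Section LayerFamily.
Context {R : realType}.
Local Notation C := R[i].
Variables (n : nat) (p : 'I_n.-1 -> R -> C).
Hypothesis n_gt0 : (0 < n)%N.
Hypothesis hp : forall k, summable01 (p k).

Lemma cL1_cst_integral (g h : R -> C) (z : C) : cL1 g -> cL1 h ->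
  integral01 (fun t => g t + z * h t) = integral01 g + z * integral01 h.
Proof.
move=> ig ih; have izh := cL1Z z ih.
rewrite (@integral01E _ (fun t => g t + z * h t)); last exact: cL1D.
by rewrite cintfromD// cintfromZ// !integral01E.
Qed.

Lemma powK (c : R) k : 0 < c -> c ^+ k * c^-1 ^+ k = 1.
Proof. by move=> c0; rewrite -exprMn divff ?gt_eqF// expr1n. Qed.

Lemma cpowK (c : R) k : 0 < c -> (c ^+ k)%:C%C * (c^-1 ^+ k)%:C%C = 1.
Proof. by move=> c0; rewrite -rmorphM /= powK. Qed.

Lemma qsol_sum (I : finType) (Y : I -> nat -> R -> C) (f : I -> R -> C) (w : I -> C) :
  (forall i, qsol p (Y i) (f i)) ->
  qsol p (fun k x => \sum_i w i * Y i k x) (fun x => \sum_i w i * f i x).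
Proof.
move=> qY; have bound (g : I -> R -> C) : (forall i, exists M, forall x, nrm (g i x) <= M) ->
    exists M, forall x, nrm (\sum_i w i * g i x) <= M.
  move=> /choice[M HM]; exists (\sum_i nrm (w i) * M i) => x.
  rewrite (le_trans (nrm_sum _ _))//; apply: ler_sum => i _.
  by rewrite (le_trans (nrmM _ _))// ler_wpM2l ?nrm_ge0.
split.
- move=> k; apply: cmeas_sum => i; apply: cmeasM; first exact: cmeas_cst.
  exact: (qsol_meas (qY i)).
- have /choice[M HM] : forall i, exists M, forall k x, nrm (Y i k x) <= M.
    by move=> i; exact: (qsol_bounded (qY i)).
  exists (\sum_i nrm (w i) * M i) => k x.
  rewrite (le_trans (nrm_sum _ _))//; apply: ler_sum => i _.
  by rewrite (le_trans (nrmM _ _))// ler_wpM2l ?nrm_ge0.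
- apply: cmeas_sum => i; apply: cmeasM; first exact: cmeas_cst.
  exact: (qsol_rhs_meas (qY i)).
- by apply: bound => i; exact: (qsol_rhs_bounded (qY i)).
move=> k x kn x01.
rewrite (eq_bigr (fun i => w i * Y i k 0 + w i * cintfrom 0 (slope p (Y i) (f i) k) x)); last first.
  by move=> i _; rewrite -mulrDr -(qsol_eq (qY i)).
rewrite big_split /=; congr (_ + _).
have is_ i : cL1 (slope p (Y i) (f i) k) by exact: slope_cL1.
under eq_bigr do rewrite -cintfromZ//.
rewrite -cintfrom_sum; last by move=> i; exact: cL1Z.
congr cintfrom; apply/funext => t; rewrite /slope /cut.
case: ifP => _; last by rewrite big1// => i _; rewrite mulr0.
case: ltnP => _.
  by rewrite mulr_sumr; apply: eq_bigr => i _; rewrite mulrCA.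
rewrite /lower_terms; under [LHS]eq_bigr do rewrite mulrCA mulrBr.
rewrite -mulr_sumr sumrB; congr (_ * (_ - _)).
under [LHS]eq_bigr do rewrite mulr_sumr.
rewrite [LHS]exchange_big /=; apply: eq_bigr => j _.
by rewrite mulr_sumr; apply: eq_bigr => i _; rewrite mulrCA.
Qed.

Local Notation T := (bool * 'I_n)%type.
Local Notation c0 := (layer_size p).

(** All the boundary layers needed below, one for each end point and each
    elementary jet, over all small widths at once. *)
Lemma layer_family :
  exists (P : T -> {poly C}) (Y : R -> T -> nat -> R -> C) (F : R -> T -> R -> C),
  [/\ forall (t : T) k, (k < n)%N -> (iter k polyD (P t)).[(base_pt t.1 : R)%:C%C] = 0 /\
        (iter k polyD (P t)).[0] = (k == t.2)%:R,
      forall c, 0 < c -> c <= c0 -> forall t, qsol p (Y c t) (F c t),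
      forall (t : T) k (e' : bool), (k < n)%N ->
        approx c0 (fun c => (c ^+ k)%:C%C * Y c t k e'%:R) ((t.1 == e') && (k == t.2))%:R &
      forall t t' : T, approx c0
        (fun c => (c ^+ n.-1)%:C%C * integral01 (fun x => F c t x * (Y c t' 0%N x)^*%C))
        (if t.1 == t'.1 then pint t.1 (iter n polyD (P t) * polyJ (P t')) else 0)].
Proof.
have /choice[P HP] : forall t : T, exists P : {poly C},
  (forall k, (k < n)%N -> (iter k polyD P).[(base_pt t.1 : R)%:C%C] = 0) /\
  (forall k, (k < n)%N -> (iter k polyD P).[0] = (k == t.2)%:R).
  by move=> [e i]; exact: jet_poly (ltn_ord i).
pose S (t : T) c := layer_itv t.1 c : interval R.
pose F c t := cut (S t c) (profile t.1 c (P t) n).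
pose good (t : T) (B c : R) (Y : nat -> R -> C) := 0 < c -> c <= c0 ->
  [/\ qsol p Y (F c t),
    forall k x, (k < n)%N -> 0 <= x <= 1 -> x \notin S t c -> Y k x = 0 &
    forall k x, (k < n)%N -> x \in S t c ->
      nrm (Y k x - profile t.1 c (P t) k x) <= B * c * c^-1 ^+ k].
have /choice[B HB] : forall t, exists B, forall c, exists Y, good t B c Y.
  move=> t; have [B HB] := layer_solution n_gt0 hp (HP t).1.
  exists B => c; rewrite /good; have [/andP[h1 h2]|h] := boolP ((0 < c) && (c <= c0)).
    by have [Y HY] := HB c h1 h2; exists Y.
  by exists (fun _ _ => 0) => h1 h2; rewrite h1 h2 in h.
have /choice[Y HY] : forall cB : R * T, exists Y, good cB.2 (B cB.2) cB.1 Y.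
  by move=> [c t]; exact: HB.
have Yq c t : 0 < c -> c <= c0 -> good t (B t) c (Y (c, t)) by move=> _ _; exact: (HY (c, t)).
exists P, (fun c t => Y (c, t)), F; split.
- by move=> t k kn; split; [exact: (HP t).1|exact: (HP t).2].
- by move=> c h1 h2 t; have [] := Yq c t h1 h2 h1 h2.
- move=> t k e' kn; exists (B t) => c h1 h2.
  have [_ Yout Yin] := Yq c t h1 h2 h1 h2.
  have [c4 _] := layer_size_le h1 h2.
  have e01 : 0 <= (e'%:R : R) <= 1 by case: e'; rewrite ?lexx ?ler01.
  have [te|te] := eqVneq t.1 e'.
    have eS : e'%:R \in S t c by rewrite /S te; exact: layer_end.
    have -> : (true && (k == t.2))%:R = (c ^+ k)%:C%C * profile t.1 c (P t) k e'%:R.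
      rewrite /profile mulrA cpowK// mul1r.
      by rewrite te subrr mul0r (HP t).2.
    rewrite -mulrBr nrmZ ger0_norm ?exprn_ge0 ?(ltW h1)//.
    apply: (le_trans (ler_wpM2l _ (Yin k _ kn eS))); first by rewrite exprn_ge0 ?(ltW h1).
    by rewrite mulrCA powK// mulr1.
  rewrite Yout ?mulr0 ?subr0 ?nrm0//.
    rewrite mulr_ge0 ?(ltW h1)//.
    have := Yin 0%N (t.1)%:R n_gt0 (layer_end _ h1); rewrite expr0 mulr1.
    by move=> /(le_trans (nrm_ge0 _)); rewrite pmulr_lge0.
  have := layer_disjoint h1 c4 (layer_end e' h1).
  by rewrite /S; case: (t.1) te; case: e' {e01}.
move=> t t'; have [M M0 HM] := profile_bounded (P t) n.
exists (2 * M * B t') => c h1 h2.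
have [c4 _] := layer_size_le h1 h2; have c2 : c <= 1 / 2 by lra.
have [qt _ _] := Yq c t h1 h2 h1 h2.
have [qt' Yout Yin] := Yq c t' h1 h2 h1 h2.
have B0 : 0 <= B t'.
  have := Yin 0%N (t'.1)%:R n_gt0 (layer_end _ h1); rewrite expr0 mulr1.
  by move=> /(le_trans (nrm_ge0 _)); rewrite pmulr_lge0.
have mY := qsol_meas qt' 0%N.
have [tt|tt] := eqVneq t.1 t'.1; last first.
  rewrite (_ : (fun x => _) = fun=> 0).
    rewrite integral01E; last exact: cL10.
    rewrite /cintfrom /re /im /= !intfrom0 mulr0 subrr nrm0.
    by rewrite mulr_ge0 ?(ltW h1)// mulr_ge0// mulr_ge0.
  apply/funext => x; rewrite /F /cut; case: ifP => xS; last by rewrite mul0r.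
  rewrite Yout ?conjc0 ?mulr0//; first exact: layer_sub01 xS.
  have := layer_disjoint h1 c4 xS; rewrite /S.
  by case: (t.1) tt; case: (t'.1).
(* The profiles give the exact limit [g1], and the error [g2] is of order [c]. *)
pose g1 x := profile t.1 c (P t) n x * (profile t'.1 c (P t') 0 x)^*%C.
pose g2 x := profile t.1 c (P t) n x * (Y (c, t') 0%N x - profile t'.1 c (P t') 0 x)^*%C.
pose G := ((c^-1) ^+ n)%:C%C *: (iter n polyD (P t) * polyJ (P t')).
have g1E : cut (S t c) g1 = cut (S t c) (fun x => G.[((x - t.1%:R) / c)%:C%C]).
  apply/funext => x; rewrite /cut; case: ifP => // _.
  rewrite /g1 /profile expr0 mul1r /G hornerZ hornerM polyJ_real /= tt.
  by rewrite mulrA.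
have m2 : cmeas g2.
  apply: cmeasM; first exact: profile_meas.
  by apply/cmeasJ/cmeasD => //; apply: cmeasN; exact: profile_meas.
have b2 x : x \in S t c -> nrm (g2 x) <= c^-1 ^+ n * M * (B t' * c).
  move=> xS; rewrite /g2 (le_trans (nrmM _ _))// nrmJ ler_pM ?nrm_ge0//.
    exact: HM.
  by have := Yin 0%N x n_gt0; rewrite /S -tt expr0 mulr1; apply.
have i2 : cL1 (cut (S t c) g2) := cut_layer_cL1 m2 b2.
have i1 : cL1 (cut (S t c) g1).
  rewrite g1E; have [M' _ HM'] := nrm_poly_bounded G.
  apply: (cut_layer_cL1 (M := M')); first exact: poly_affine_meas.
  by move=> x xS; apply: HM'; exact: layer_scale.
rewrite (_ : (fun x => F c t x * _) = fun x => cut (S t c) g1 x + 1 * cut (S t c) g2 x); last first.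
  apply/funext => x; rewrite /F /cut; case: ifP => _; last by rewrite mul0r mulr0 addr0.
  by rewrite mul1r /g1 /g2 -mulrDr -rmorphD /= addrC subrK.
rewrite cL1_cst_integral// mul1r g1E integral01_layer// mulrDr.
have -> : (c ^+ n.-1)%:C%C * (c%:C%C * pint t.1 G) = pint t.1 (iter n polyD (P t) * polyJ (P t')).
  have := pint_lin t.1 [:: tt] (fun=> ((c^-1) ^+ n)%:C%C) (fun=> iter n polyD (P t) * polyJ (P t')).
  rewrite !big_cons !big_nil !addr0 => ->.
  rewrite !mulrA -!rmorphM -exprSr prednK// -exprMn divff ?gt_eqF// expr1n.
  by rewrite mul1r.
rewrite addrAC subrr add0r nrmZ ger0_norm ?exprn_ge0 ?(ltW h1)// integral01E//.
have b0 : 0 <= c^-1 ^+ n * M * (B t' * c).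
  by rewrite !mulr_ge0 ?exprn_ge0 ?invr_ge0 ?(ltW h1).
have := le_trans (cintfrom_le _ _ i2) (cnorm1_cut_layer h1 b0 m2 b2).
move=> /(_ 0 1) /(ler_wpM2l (exprn_ge0 n.-1 (ltW h1))) /le_trans; apply.
rewrite le_eqVlt; apply/orP; left; apply/eqP.
have -> : c^-1 ^+ n = c^-1 * c^-1 ^+ n.-1 by rewrite -exprS prednK.
have cn : c ^+ n.-1 != 0 by rewrite expf_neq0// gt_eqF.
by rewrite exprVn; field; rewrite cn gt_eqF.
Qed.

End LayerFamily.

(** * The boundary form of a dissipative operator *)

Section BoundaryForm.
Context {R : realType}.
Local Notation C := R[i].
Variables (n : nat) (p : 'I_n.-1 -> R -> C) (bc : bconds C n).
Hypothesis n_gt0 : (0 < n)%N.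
Hypothesis hp : forall k, summable01 (p k).
Local Notation T := (bool * 'I_n)%type.
Local Notation row := {j : 'I_n & 'I_(bc_num bc j)}.
Local Notation N := (\sum_(j < n) bc_num bc j)%N.

Definition lead (e : bool) (x : row) : C := bc_lead bc e (tag x) (tagged x) 0.

Definition low (e : bool) (x : row) (s : 'I_(tag x)) : C :=
  bc_low bc e s (tagged x) 0.

(** The Hermitian form of Lagrange's identity on Cauchy data. *)
Definition cauchy_form (U : nat -> C) : C :=
  \sum_(k < n) U (n.-1 - k)%N * (U k)^*%C.

Lemma polyD_linear (I : Type) (s : seq I) (w : I -> C) (F : I -> {poly C}) k :
  iter k polyD (\sum_(i <- s) w i *: F i) = \sum_(i <- s) w i *: iter k polyD (F i).
Proof.
elim: k => [//|k IH]; rewrite iterS IH /polyD raddf_sum /= scaler_sumr.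
by apply: eq_bigr => i _; rewrite derivZ scalerA mulrC -scalerA.
Qed.

Lemma pint_hermitian e (w : 'I_n -> C) (A B : 'I_n -> {poly C}) :
  pint e ((\sum_i w i *: A i) * polyJ (\sum_i w i *: B i)) =
  \sum_i \sum_j w i * (w j)^*%C * pint e (A i * polyJ (B j)).
Proof.
have -> : polyJ (\sum_i w i *: B i) = \sum_i (w i)^*%C *: polyJ (B i).
  rewrite /polyJ raddf_sum; apply: eq_bigr => i _ /=; exact: map_polyZ.
rewrite big_distrlr /= pair_bigA /=.
under eq_bigr do rewrite -scalerAl -scalerAr scalerA.
by rewrite pint_lin pair_bigA.
Qed.

(** The leading parts of the conditions of order [j] involve derivatives of order
    [j] only, and have full row rank. *)
Lemma lead_right_inverse : normalized bc -> exists V : T -> row -> C,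
  forall x y : row, \sum_(t : T) (t.2 == tag x)%:R * lead t.1 x * V t y = (x == y)%:R.
Proof.
move=> hbc; pose b01 j := row_mx (bc_lead bc false j) (bc_lead bc true j).
have inv j : b01 j *m pinvmx (b01 j) = 1%:M.
  apply: mulmxVp; have [_ rk _] := hbc j.
  by rewrite /row_free rk.
pose ix (e : bool) : 'I_(1 + 1) := if e then rshift 1 ord0 else lshift 1 ord0.
exists (fun t y => (t.2 == tag y)%:R * pinvmx (b01 (tag y)) (ix t.1) (tagged y)).
move=> [j a] [k b] /=.
rewrite sum_pair /=.
rewrite (eq_bigr (fun e => (j == k)%:R * (lead e (Tagged _ a) * pinvmx (b01 k) (ix e) b))); last first.
  move=> e _; rewrite (bigD1 j)//= big1 ?addr0; last first.
    by move=> i /negbTE ->; rewrite !mul0r.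
  by rewrite eqxx mul1r mulrCA.
rewrite -mulr_sumr; have [jk|jk] := eqVneq j k; last first.
  rewrite mul0r; case: eqP => // - [jk' _].
  by rewrite jk' eqxx in jk.
case: k / jk b => b; rewrite mul1r eq_Tagged /=.
have := congr1 (fun A : 'M[C]_(bc_num bc j) => A a b) (inv j).
rewrite !mxE big_split_ord /= !big_ord1 => H.
rewrite big_bool /= /lead /= addrC -H; congr (_ * _ + _ * _); rewrite /b01.
  by rewrite row_mxEl.
by rewrite row_mxEr.
Qed.

(** A solution of a limiting system of full row rank is a limit of solutions of
    the nearby systems. Writing the correction with determinants and adjugates
    makes it polynomial in the coefficients, so that no inverse has to be
    estimated. *)
Lemma correct_kernel (m : nat) (c0 : R) (M : R -> 'I_m -> T -> C) (M0 : 'I_m -> T -> C)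
    (V : T -> 'I_m -> C) (w : T -> C) : 0 < c0 -> c0 <= 1 ->
  (forall r t, approx c0 (fun c => M c r t) (M0 r t)) ->
  (forall r s, \sum_t M0 r t * V t s = (r == s)%:R) ->
  (forall r, \sum_t M0 r t * w t = 0) ->
  exists W : R -> T -> C, (forall c r, \sum_t M c r t * W c t = 0) /\
    forall t, approx c0 (fun c => W c t) (w t).
Proof.
move=> c00 c01 MM0 M0V M0w.
pose G c : 'M[C]_m := \matrix_(r, s) \sum_t M c r t * V t s.
pose mw c r := \sum_t M c r t * w t.
have apG r s : approx c0 (fun c => G c r s) ((1%:M : 'M[C]_m) r s).
  rewrite mxE -M0V; apply: (@approx_eq _ _ (fun c => \sum_t M c r t * V t s)).
    by move=> c _ _; rewrite mxE.
  by apply: approx_sum => t; apply: approxM => //; exact: approx_cst.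
have apw r : approx c0 (fun c => mw c r) 0.
  rewrite -(M0w r); apply: approx_sum => t; apply: approxM => //; exact: approx_cst.
exists (fun c t => \det (G c) * w t - \sum_s V t s * \sum_r (\adj (G c)) s r * mw c r); split.
  move=> c r; under eq_bigr do rewrite mulrBr mulrCA.
  rewrite sumrB -mulr_sumr -/(mw c r); apply/eqP; rewrite subr_eq0; apply/eqP.
  transitivity (\sum_s G c r s * \sum_u (\adj (G c)) s u * mw c u); last first.
    under [RHS]eq_bigr do rewrite mulr_sumr.
    rewrite [RHS]exchange_big /=; apply: eq_bigr => s _.
    by rewrite mxE mulr_suml; apply: eq_bigr => t _; rewrite mulrA.
  transitivity (\sum_u (G c *m \adj (G c)) r u * mw c u).
    rewrite mul_mx_adj (bigD1 r)//= big1 ?addr0; last first.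
      by move=> u ur; rewrite mxE eq_sym (negbTE ur) mulr0n mul0r.
    by rewrite mxE eqxx mulr1n.
  under eq_bigr do rewrite mxE mulr_suml.
  rewrite exchange_big /=; apply: eq_bigr => s _.
  by rewrite mulr_sumr; apply: eq_bigr => u _; rewrite mulrA.
move=> t; rewrite [X in approx _ _ X](_ : w t = \det (1%:M : 'M[C]_m) * w t +
    (-1) * \sum_s V t s * \sum_r (\adj (1%:M : 'M[C]_m)) s r * 0); last first.
  rewrite det1 mul1r big1 ?mulr0 ?addr0// => s _.
  by rewrite big1 ?mulr0// => r _; rewrite mulr0.
apply: (@approx_eq _ _ (fun c => \det (G c) * w t +
    (-1) * \sum_s V t s * \sum_r (\adj (G c)) s r * mw c r)).
  by move=> c _ _; rewrite mulN1r.
apply: approxD; first by apply: approxM => //; [exact: approx_det|exact: approx_cst].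
apply: approxZ => //; apply: approx_sum => s; apply: approxZ => //.
apply: approx_sum => r; apply: approxM => //; exact: approx_adj.
Qed.

(** Dissipativity, tested on boundary layers of vanishing width, says that the
    boundary form of Lagrange's identity is nonnegative on the Cauchy data that
    satisfy the leading parts of the boundary conditions. *)
Lemma dissipative_cauchy_form (u : bool -> nat -> C) : normalized bc -> dissipative p bc ->
  (forall x : row, \sum_(e : bool) lead e x * u e (tag x) = 0) ->
  0 <= complex.Re (cauchy_form (u false) - cauchy_form (u true)).
Proof.
move=> hbc hL hu.
pose c0 := layer_size p; have c00 : 0 < c0 := layer_size_gt0 p.
have c01 : c0 <= 1 by rewrite ge_min; apply/orP; left; lra.
have [V' HV'] := lead_right_inverse hbc.
have [P [Y [F [HP HY Yend Yint]]]] := layer_family n_gt0 hp.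
pose X : 'I_N -> row := @tagnat.sig n (bc_num bc).
pose bf (c : R) (t : T) (x : row) : C := \sum_(e : bool) (Y c t (tag x) e%:R * lead e x +
  \sum_(s < tag x) Y c t s e%:R * low e s).
pose M c (r : 'I_N) (t : T) : C := (c ^+ tag (X r))%:C%C * bf c t (X r).
pose M0 (r : 'I_N) (t : T) : C := (t.2 == tag (X r))%:R * lead t.1 (X r).
pose w (t : T) : C := u t.1 t.2.
have [W [W0 Wapp]] : exists W : R -> T -> C, (forall c r, \sum_t M c r t * W c t = 0) /\
    forall t, approx c0 (fun c => W c t) (w t).
  apply: (@correct_kernel _ _ M M0 (fun t s => V' t (X s)) w) => //.
  - move=> r t; set x := X r.
    pose m c := \sum_(e : bool) ((c ^+ tag x)%:C%C * Y c t (tag x) e%:R * lead e x +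
      \sum_(s < tag x) (c ^+ (tag x - s.+1).+1)%:C%C * ((c ^+ s)%:C%C * Y c t s e%:R) * low e s).
    apply: (@approx_eq _ _ m).
      move=> c _ _; rewrite /m /M /bf mulr_sumr; apply: eq_bigr => e _.
      rewrite mulrDr mulr_sumr mulrA; congr (_ + _); apply: eq_bigr => s _.
      rewrite !mulrA; congr (_ * _ * _); rewrite -rmorphM /= -exprD.
      by rewrite addSnnS subnK//.
    rewrite (_ : M0 r t = \sum_(e : bool) (((t.1 == e) && (tag x == t.2 :> nat))%:R * lead e x +
        \sum_(s < tag x) 0)); last first.
      rewrite /M0 -/x big_bool !big1 ?addr0// eq_sym -val_eqE /=.
      by case: (t.1); rewrite /= ?mul0r ?add0r ?addr0.
    apply: approx_sum => e; apply: approxD.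
      by apply: approxM => //; [apply: Yend; exact: ltn_ord|exact: approx_cst].
    apply: approx_sum => s; apply: approx_small => //.
    by apply: Yend; apply: ltn_trans (ltn_ord s) (ltn_ord _).
  - move=> r s; rewrite HV' /X inj_eq//; exact: tagnat.sig_inj.
  - move=> r; rewrite -[RHS](hu (X r)) sum_pair /=; apply: eq_bigr => e _.
    rewrite (bigD1 (tag (X r)))//= big1 ?addr0; last first.
      by move=> i ir; rewrite /M0 /= (negbTE ir) !mul0r.
    by rewrite /M0 /= eqxx mul1r.
pose lam (t t' : T) : C :=
  if t.1 == t'.1 then pint t.1 (iter n polyD (P t) * polyJ (P t')) else 0.
pose ap c := \sum_t \sum_t' W c t * (W c t')^*%C *
  ((c ^+ n.-1)%:C%C * integral01 (fun x => F c t x * (Y c t' 0%N x)^*%C)).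
have Hap : approx c0 ap (\sum_t \sum_t' w t * (w t')^*%C * lam t t').
  apply: approx_sum => t; apply: approx_sum => t'; apply: (approxM c01 _ (Yint t t')).
  by apply: approxM => //; exact: approxJ.
have Him : 0 <= complex.Im (\sum_t \sum_t' w t * (w t')^*%C * lam t t').
  apply: (approx_Im_ge0 c00 Hap) => c h1 h2.
  have qY := qsol_sum hp (W c) (HY c h1 h2).
  have dom := qsol_in_domain n_gt0 hp qY (bc := bc).
  have /dom : forall j : 'I_n, \sum_(e : bool) (
      (\sum_t W c t * Y c t j e%:R) *: bc_lead bc e j +
      \sum_(s < j) (\sum_t W c t * Y c t s e%:R) *: bc_low bc e s) = 0.
    move=> j; apply/matrixP => a z; rewrite (ord1 z) [RHS]mxE.
    have := W0 c (tagnat.rank (Tagged _ a)).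
    rewrite /M /X tagnat.rankK /= => H.
    have cj : (c ^+ j)%:C%C != 0 :> C.
      by rewrite fmorph_eq0 expf_neq0// gt_eqF.
    apply: (mulfI cj); rewrite mulr0 -[RHS]H summxE.
    under [RHS]eq_bigr do rewrite -mulrA.
    rewrite -mulr_sumr; congr (_ * _).
    rewrite /bf /=; under [RHS]eq_bigr do rewrite mulr_suml.
    rewrite [RHS]exchange_big /=; apply: eq_bigr => e _.
    under [RHS]eq_bigr do rewrite mulrDl.
    rewrite big_split /= !mxE summxE; congr (_ + _).
      by rewrite mulr_suml; apply: eq_bigr => t _; rewrite /lead /=; ring.
    under [RHS]eq_bigr do rewrite mulr_suml.
    rewrite [RHS]exchange_big /=; apply: eq_bigr => s _.
    by rewrite mxE mulr_suml; apply: eq_bigr => t _; rewrite /low /=; ring.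
  move=> /hL; rewrite (qsol_inner n_gt0 hp qY).
  rewrite (_ : integral01 _ = \sum_t \sum_t' W c t * (W c t')^*%C *
      integral01 (fun x => F c t x * (Y c t' 0%N x)^*%C)).
    move=> H; rewrite (_ : ap c = (c ^+ n.-1)%:C%C * \sum_t \sum_t' W c t * (W c t')^*%C *
      integral01 (fun x => F c t x * (Y c t' 0%N x)^*%C)).
      by rewrite ImM /= mul0r addr0 mulr_ge0// exprn_ge0 ?(ltW h1).
    rewrite /ap mulr_sumr; apply: eq_bigr => t _; rewrite mulr_sumr.
    by apply: eq_bigr => t' _; rewrite mulrCA.
  have iFY t t' : cL1 (cut `]0, 1[ (fun x => F c t x * (Y c t' 0%N x)^*%C)).
    have [M1 HM1] := qsol_rhs_bounded (HY c h1 h2 t).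
    have [M2 HM2] := qsol_bounded (HY c h1 h2 t').
    apply: (@cut_bounded_cL1 _ _ _ _ _ _ (M1 * M2)).
      apply: cmeasM; first exact: (qsol_rhs_meas (HY c h1 h2 t)).
      by apply: cmeasJ; exact: (qsol_meas (HY c h1 h2 t')).
    by move=> x _; rewrite (le_trans (nrmM _ _))// nrmJ ler_pM ?nrm_ge0.
  have icut (g : R -> C) : cL1 (cut `]0, 1[ g) -> integral01 g = cintfrom 0 (cut `]0, 1[ g) 1.
    move=> ig; rewrite -integral01E// /integral01; congr (_ +i* _)%C;
      by apply: eq_Rintegral => x; rewrite inE /re /im => xI; rewrite cut_in.
  have Ecut : cut `]0, 1[ (fun x => (\sum_t W c t * F c t x) *
      (\sum_t W c t * Y c t 0%N x)^*%C) =
    (fun x => \sum_t \sum_t' W c t * (W c t')^*%C *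
        cut `]0, 1[ (fun x => F c t x * (Y c t' 0%N x)^*%C) x).
    apply/funext => x; rewrite /cut; case: ifP => _; last first.
      by rewrite big1// => t _; rewrite big1// => t' _; rewrite mulr0.
    rewrite rmorph_sum big_distrlr /=; apply: eq_bigr => t _; apply: eq_bigr => t' _.
    by rewrite rmorphM mulrACA.
  have iS t : cL1 (fun x => \sum_t' W c t * (W c t')^*%C *
      cut `]0, 1[ (fun x => F c t x * (Y c t' 0%N x)^*%C) x).
    by apply: cL1_sum => t'; exact: cL1Z.
  rewrite icut Ecut; last by apply: cL1_sum.
  rewrite cintfrom_sum//; apply: eq_bigr => t _.
  rewrite cintfrom_sum; last by move=> t'; exact: cL1Z.
  by apply: eq_bigr => t' _; rewrite cintfromZ// -icut.
pose Q e : {poly C} := \sum_(i < n) u e i *: P (e, i).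
have Qlam : \sum_t \sum_t' w t * (w t')^*%C * lam t t' =
    \sum_(e : bool) pint e (iter n polyD (Q e) * polyJ (Q e)).
  rewrite sum_pair; apply: eq_bigr => e _.
  rewrite /Q polyD_linear pint_hermitian; apply: eq_bigr => i _.
  rewrite sum_pair (bigD1 e)//= [X in _ + X]big1 ?addr0; last first.
    by move=> e' ee'; rewrite big1// => j _; rewrite /lam /= eq_sym (negbTE ee') mulr0.
  by apply: eq_bigr => j _; rewrite /lam /= eqxx.
have Qb e k : (k < n)%N -> (iter k polyD (Q e)).[(base_pt e : R)%:C%C] = 0.
  move=> kn; rewrite /Q polyD_linear horner_sum big1// => i _.
  by rewrite hornerZ (HP (e, i) k kn).1 mulr0.
have Q0 e k : (k < n)%N -> (iter k polyD (Q e)).[0] = u e k.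
  move=> kn; rewrite /Q polyD_linear horner_sum (bigD1 (Ordinal kn))//= big1 ?addr0.
    by rewrite hornerZ (HP (e, Ordinal kn) k kn).2 eqxx mulr1.
  move=> i ik; rewrite hornerZ (HP (e, i) k kn).2 /=.
  by rewrite (_ : (k == i) = false) ?mulr0//; apply: contraNF ik => /eqP ki; apply/eqP/val_inj.
have gr e : pint e (iter n polyD (Q e) * polyJ (Q e)) - (pint e (iter n polyD (Q e) * polyJ (Q e)))^*%C
   = (base_pt e)%:C%C * 'i%C * cauchy_form (u e).
  rewrite (pint_green (Qb e)).
  congr (_ * _); apply: eq_bigr => k _; rewrite !Q0//.
  by have := ltn_ord k; lia.
rewrite Qlam in Him; move: (gr true) (gr false) Him; rewrite big_bool ImD.
move=> /(congr1 (@complex.Im R)) + /(congr1 (@complex.Im R)).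
rewrite !ImD !ImN !ImJ !ReD !ReN !ImM !ReM /base_pt /=.
lra.
Qed.

End BoundaryForm.

(** * Cauchy matrices *)

Section CauchyMatrix.
Context {R : realType}.
Local Notation C := R[i].

Lemma conj_sub_neq0 (z w : C) : 0 < complex.Im z -> 0 < complex.Im w -> z - (w^*)%C != 0.
Proof.
move=> z0 w0; apply/eqP => /(congr1 (@complex.Im R)).
by rewrite ImD ImN ImJ /= opprK => h; move: z0 w0; lra.
Qed.

Definition cauchy_gram (I : Type) (s : seq I) (z c : I -> C) : C :=
  \sum_(a <- s) \sum_(b <- s) c a * (c b)^*%C * ('i%C / (z a - (z b)^*%C)).

(** Positive definiteness of the Cauchy matrix: its Schur complement with respect
    to one point is again a Cauchy matrix, rescaled by Blaschke factors that
    vanish only at that point. *)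
Lemma cauchy_gram_definite (I : eqType) (s : seq I) (z c : I -> C) :
  uniq s -> {in s &, injective z} -> {in s, forall a, 0 < complex.Im (z a)} ->
  0 <= cauchy_gram s z c /\ (cauchy_gram s z c = 0 -> {in s, forall a, c a = 0}).
Proof.
elim: s c => [|o s IH] c.
  by rewrite /cauchy_gram big_nil.
move=> /=/andP[os us] zinj zpos.
have zo : 0 < complex.Im (z o) by apply: zpos; rewrite inE eqxx.
have oo := conj_sub_neq0 zo zo.
have i0 : 'i%C != 0 :> C by rewrite eq_complex /= eqxx oner_eq0.
have [phi phiE] : exists phi : I -> C, forall a, phi a = (z a - z o) / (z a - (z o)^*%C).
  by exists (fun a => (z a - z o) / (z a - (z o)^*%C)).
have [K KE] : exists K : I -> I -> C, forall a b, K a b = 'i%C / (z a - (z b)^*%C).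
  by exists (fun a b => 'i%C / (z a - (z b)^*%C)).
have Koo : 0 < K o o.
  rewrite KE; have -> : z o - (z o)^*%C = 2 * (complex.Im (z o))%:C%C * 'i%C by exact: subcJ.
  rewrite invfM mulrCA mulfV// mulr1 invr_gt0 mulr_gt0//.
  by rewrite ltcR.
have zb b : b \in o :: s -> (z o - (z b)^*%C) != 0.
  by move=> bs; apply: conj_sub_neq0 => //; exact: zpos.
have az a : a \in o :: s -> (z a - (z o)^*%C) != 0.
  by move=> bs; apply: conj_sub_neq0 => //; exact: zpos.
have ab a b : a \in o :: s -> b \in o :: s -> (z a - (z b)^*%C) != 0.
  by move=> h1 h2; apply: conj_sub_neq0 => //; exact: zpos.
have KJ b : b \in o :: s -> K o b = ((K b o)^*)%C.
  move=> bs; rewrite !KE rmorphM fmorphV rmorphB /= conjcK.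
  have -> : (0 -i* 1)%C = - 'i%C :> C by apply: complexP; rewrite /= ?oppr0.
  by rewrite mulNr -mulrN -invrN opprB.
have phiJ b : (phi b)^*%C = ((z b)^*%C - (z o)^*%C) / ((z b)^*%C - z o).
  by rewrite phiE rmorphM fmorphV !rmorphB /= conjcK.
have Kab a b : a \in o :: s -> b \in o :: s ->
    K a b = K a o * K o b / K o o + phi a * (phi b)^*%C * K a b.
  move=> ha hb; rewrite phiJ phiE !KE; field.
  rewrite i0 oo az// ab// zb//= andbT.
  by rewrite -opprB oppr_eq0 zb.
pose X : C := \sum_(a <- o :: s) c a * K a o.
have E : cauchy_gram (o :: s) z c = X * (X^*)%C / K o o +
    cauchy_gram s z (fun a => c a * phi a).
  have phio : phi o = 0 by rewrite phiE subrr mul0r.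
  transitivity (X * (X^*)%C / K o o + cauchy_gram (o :: s) z (fun a => c a * phi a)).
    rewrite /X rmorph_sum big_distrlr /= mulr_suml /cauchy_gram -big_split /=.
    rewrite [LHS]big_seq [RHS]big_seq; apply: eq_bigr => a ha.
    rewrite mulr_suml -big_split /= [LHS]big_seq [RHS]big_seq; apply: eq_bigr => b hb.
    rewrite -!KE {1}Kab// mulrDr; congr (_ + _).
      by rewrite rmorphM /= -KJ// !mulrA; congr (_ * _ / _); exact: mulrAC.
    by rewrite rmorphM /= !mulrA; congr (_ * _ * _); exact: mulrAC.
  congr (_ + _); rewrite /cauchy_gram big_cons big1 ?add0r; last first.
    by move=> b _; rewrite phio mulr0 !mul0r.
  apply: eq_bigr => a _; rewrite big_cons phio mulr0 rmorph0 mulr0 mul0r add0r.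
  by [].
have sub : {subset s <= o :: s} by move=> a h; rewrite inE h orbT.
have [IH0 IH1] := IH (fun a => c a * phi a) us (sub_in2 sub zinj) (sub_in1 sub zpos).
have X0 : 0 <= X * (X^*)%C / K o o by rewrite divr_ge0 ?mulcJ_ge0// ltW.
split; first by rewrite E addr_ge0.
rewrite E => /eqP; rewrite paddr_eq0// => /andP[/eqP XX /eqP /IH1 G0].
have cs a : a \in s -> c a = 0.
  move=> ha; have /eqP := G0 a ha; rewrite mulf_eq0 => /orP[/eqP//|].
  rewrite phiE mulf_eq0 invr_eq0 (negbTE (az a (sub a ha))) orbF subr_eq0 => /eqP /zinj.
  by move=> h; move: os; rewrite -h ?ha// ?inE ?ha ?eqxx ?orbT.
have X00 : X = 0.
  have /eqP := XX; rewrite mulf_eq0 invr_eq0 (gt_eqF Koo) orbF mulf_eq0 conjc_eq0 orbb.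
  by move/eqP.
move=> a; rewrite inE => /predU1P[->|]; last exact: cs.
move: X00; rewrite /X big_cons big_seq big1 ?addr0; last first.
  by move=> b hb; rewrite cs// mul0r.
by move/eqP; rewrite mulf_eq0 (gt_eqF Koo) orbF => /eqP.
Qed.

(** On exponentials with [z ^ n = - i] the Lagrange form is minus twice a Cauchy
    form: this is the energy identity for decaying exponentials, done
    algebraically. *)
Lemma cauchy_form_exponentials n (I : eqType) (s : seq I) (z c : I -> C) :
  (forall a, z a ^+ n = - 'i%C) ->
  {in s &, forall a b, z a - (z b)^*%C != 0} ->
  cauchy_form n (fun j => \sum_(a <- s) c a * z a ^+ j) = - 2 * cauchy_gram s z c.
Proof.
move=> zn zz; rewrite /cauchy_form.
under eq_bigr do rewrite rmorph_sum big_distrlr /=.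
rewrite exchange_big /= /cauchy_gram mulr_sumr [LHS]big_seq [RHS]big_seq.
apply: eq_bigr => a ha.
rewrite exchange_big /= mulr_sumr [LHS]big_seq [RHS]big_seq; apply: eq_bigr => b hb.
transitivity (c a * (c b)^*%C * \sum_(k < n) z a ^+ (n.-1 - k) * (z b)^*%C ^+ k).
  rewrite mulr_sumr; apply: eq_bigr => k _.
  by rewrite rmorphM rmorphXn /= mulrACA.
rewrite [RHS]mulrCA; congr (_ * _).
apply: (mulfI (zz a b ha hb)); rewrite -subrXX zn -rmorphXn zn.
rewrite [RHS](_ : _ = - 2 * 'i%C); last by field; exact: zz.
by apply: complexP; rewrite /= ?mul0r ?mulr0 ?oppr0 ?subrr//; ring.
Qed.

End CauchyMatrix.

(** * Regularity *)

Section Regularity.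
Context {R : realType}.
Local Notation C := R[i].

Definition cis (t : R) : C := (cos t +i* sin t)%C.

Lemma cisD s t : cis (s + t) = cis s * cis t.
Proof. by apply: complexP; rewrite ?ReM ?ImM /= ?cosD ?sinD //; ring. Qed.

Lemma cisX t k : cis t ^+ k = cis (k%:R * t).
Proof.
elim: k => [|k IH]; first by rewrite expr0 mul0r /cis cos0 sin0.
by rewrite exprS IH -cisD; congr cis; rewrite -[in RHS]natr1; ring.
Qed.

Variable n : nat.
Hypothesis n_gt0 : (0 < n)%N.
Hypothesis n_even : ~~ odd n.

(* Rotating the roots of unity by three quarters of their angular distance puts
   their n-th power at -i, in the lower half-plane, and moves them off the real
   axis. *)
Let theta (k : nat) : R := pi * (4 * k%:R + 3) / (2 * n%:R).
Let z (k : nat) : C := cis (theta k).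
Let omega : C := cis (theta 0).

Let n0 : (n%:R : R) != 0. Proof. by rewrite pnatr_eq0 -lt0n. Qed.

Let nR : 0 < n%:R :> R. Proof. by rewrite ltr0n. Qed.

Let zE k : z k = omega * @eps R n k.
Proof.
rewrite /z /omega -[eps _ _]/(cis _) -cisD; congr cis.
by rewrite /theta; field.
Qed.

Let zn k : z k ^+ n = - 'i%C.
Proof.
rewrite zE exprMn cisX -[eps _ _]/(cis _) cisX.
have -> : n%:R * (2 * pi * k%:R / n%:R) = k%:R * (pi *+ 2) :> R.
  by rewrite -mulr_natr; field.
rewrite -(cisX (pi *+ 2)) (_ : cis (pi *+ 2) = 1) ?expr1n ?mulr1; last first.
  by rewrite /cis cos2pi sin2pi.
have -> : n%:R * theta 0 = pi + pi / 2 by rewrite /theta; field.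
rewrite cisD /cis cospi sinpi cos_pihalf sin_pihalf.
by apply: complexP; rewrite ?ReM ?ImM /=; ring.
Qed.

Let nE : n%:R = 2 * (n./2)%:R :> R.
Proof. by rewrite -[in LHS](even_halfK n_even) -mul2n natrM. Qed.

Let theta_upper k : (k < n./2)%N -> 0 < theta k < pi.
Proof.
move=> kq; have pi0 := @pi_gt0 R.
have h : k%:R + 1 <= (n./2)%:R :> R by rewrite natr1 ler_nat.
have k0 : 0 <= k%:R :> R by rewrite ler0n.
apply/andP; split.
  by rewrite /theta divr_gt0// ?mulr_gt0//; lra.
rewrite /theta ltr_pdivrMr ?mulr_gt0// ltr_pM2l// nE; lra.
Qed.

Let theta_lower k : (n./2 <= k)%N -> (k < n)%N -> 0 < theta k - pi < pi.
Proof.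
move=> qk kn; have pi0 := @pi_gt0 R.
have h : k%:R + 1 <= n%:R :> R by rewrite natr1 ler_nat.
have k0 : (n./2)%:R <= k%:R :> R by rewrite ler_nat.
have -> : theta k - pi = pi * (4 * k%:R + 3 - 2 * n%:R) / (2 * n%:R).
  by rewrite /theta; field.
apply/andP; split.
  by rewrite divr_gt0// ?mulr_gt0// nE; lra.
rewrite ltr_pdivrMr ?mulr_gt0// ltr_pM2l//; lra.
Qed.

Let theta_inj : injective theta.
Proof.
move=> a b; rewrite /theta => /(congr1 (fun x => x * (2 * n%:R) / pi)).
have pi0 : pi != 0 :> R by rewrite gt_eqF// pi_gt0.
have E (u x : R) : u != 0 -> u * x / (2 * n%:R) * (2 * n%:R) / u = x.
  by move=> u0; field; rewrite n0 u0.
rewrite !E// => h; apply/eqP; rewrite -(@eqr_nat R); apply/eqP; lra.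
Qed.

(* At the right end point the exponents lie in the lower half-plane, and a change
   of sign brings them back to the upper one. *)
Let sgn (e : bool) : C := if e then -1 else 1.

Let half (e : bool) : seq 'I_n := [seq k : 'I_n <- index_enum 'I_n | (n./2 <= k)%N == e].

Let half_Im e : {in half e, forall k : 'I_n, 0 < complex.Im (sgn e * z k)}.
Proof.
move=> k; rewrite mem_filter => /andP[/eqP ke _]; rewrite /sgn.
case: e ke => [qk|/negbT].
  rewrite mulN1r ImN /z /cis /= -(subrK pi (theta k)) sinDpi opprK.
  by apply: sin_gt0_pi; exact: theta_lower.
by rewrite -ltnNge mul1r /= => /theta_upper /sin_gt0_pi.
Qed.

Let half_inj e : {in half e &, injective (fun k : 'I_n => sgn e * z k)}.
Proof.
move=> a b; rewrite !mem_filter => /andP[/eqP ae _] /andP[/eqP be _].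
move=> /(congr1 (@complex.Re R)); rewrite !ReM /sgn /z /cis /=.
case: e ae be => [qa qb|/negbT qa /negbT qb] /= h; apply/val_inj/theta_inj.
  have ca : cos (theta a - pi) = cos (theta b - pi).
    have H k : cos (theta k - pi) = - cos (theta k).
      by rewrite -[in RHS](subrK pi (theta k)) cosDpi opprK.
    by rewrite !H; move: h; rewrite oppr0 !mul0r !subr0 !mulN1r.
  apply: (addIr (- pi)); apply: cos_inj ca; rewrite in_itv/=.
    by have /andP[h1 h2] := theta_lower qa (ltn_ord a); rewrite !ltW.
  by have /andP[h1 h2] := theta_lower qb (ltn_ord b); rewrite !ltW.
rewrite -!ltnNge in qa qb.
apply: cos_inj; rewrite ?in_itv/=.
- by have /andP[h1 h2] := theta_upper qa; rewrite !ltW.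
- by have /andP[h1 h2] := theta_upper qb; rewrite !ltW.
- by move: h; rewrite !mul0r !subr0 !mul1r.
Qed.

Let half_form e (c : 'I_n -> C) :
  cauchy_form n (fun j => \sum_(k <- half e) c k * z k ^+ j) =
  - 2 * sgn e * cauchy_gram (half e) (fun k => sgn e * z k) c.
Proof.
rewrite cauchy_form_exponentials//.
  rewrite -mulrA; congr (_ * _); rewrite /cauchy_gram mulr_sumr; apply: eq_bigr => a _.
  rewrite mulr_sumr; apply: eq_bigr => b _.
  rewrite [RHS]mulrCA; congr (_ * _); rewrite rmorphM /sgn; case: (e).
    by rewrite rmorphN1 !mulN1r -opprD invrN mulrN opprK.
  by rewrite rmorph1 !mul1r.
move=> a b ha hb; have := conj_sub_neq0 (half_Im ha) (half_Im hb).
rewrite rmorphM /sgn; case: (e); last by rewrite rmorph1 !mul1r.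
by rewrite rmorphN1 !mulN1r -opprD oppr_eq0.
Qed.

Variables (p : 'I_n.-1 -> R -> C) (bc : bconds C n).
Hypothesis hp : forall k, summable01 (p k).
Hypothesis hbc : normalized bc.
Hypothesis hL : dissipative p bc.

(** A relation between the columns gives exponentials that decay away from the two
    end points, satisfy the leading boundary conditions and have spectral
    parameter [- i]; their Lagrange form is negative unless the relation is
    trivial. *)
Lemma dissipative_Theta nu : Theta bc nu != 0.
Proof.
apply/negP; rewrite /Theta -det_tr => /det0P[v v0 vA].
pose c (k : 'I_n) : C := v 0 k.
have rowE (x : {j : 'I_n & 'I_(bc_num bc j)}) :
    \sum_(k < n) c k * (eps n k ^+ tag x * lead (n./2 <= k)%N x) = 0.
  rewrite -(tagnat.rankK x); set r := tagnat.rank x.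
  have := congr1 (fun A : 'rV[C]_n => A 0 (cast_ord (bc_total bc) r)) vA.
  rewrite !mxE => H; rewrite -[RHS]H; apply: eq_bigr => k _; congr (_ * _).
  rewrite mxE castmxE /= cast_ordK cast_ord_id mxE /Bcol.
  by rewrite /mxcol mxE mxE.
pose u e j : C := \sum_(k <- half e) c k * z k ^+ j.
have hu (x : {j : 'I_n & 'I_(bc_num bc j)}) :
    \sum_(e : bool) lead e x * u e (tag x) = 0.
  transitivity (omega ^+ tag x * \sum_(k < n)
    c k * (eps n k ^+ tag x * lead (n./2 <= k)%N x)); last by rewrite rowE mulr0.
  rewrite [in RHS](partition_big (fun k : 'I_n => (n./2 <= k)%N) xpredT)//= [RHS]mulr_sumr.
  apply: eq_bigr => e _; rewrite /u /half big_filter !mulr_sumr.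
  apply: eq_bigr => k /eqP ->; rewrite zE exprMn; ring.
have := dissipative_cauchy_form n_gt0 hp hbc hL hu.
rewrite /u !half_form /sgn.
have uh e : uniq (half e) by rewrite filter_uniq// index_enum_uniq.
have [G0 Z0] := cauchy_gram_definite c (uh false) (@half_inj false) (@half_Im false).
have [G1 Z1] := cauchy_gram_definite c (uh true) (@half_inj true) (@half_Im true).
move: G0 G1 Z0 Z1; rewrite /sgn.
set g0 := cauchy_gram _ _ _; set g1 := cauchy_gram _ _ _.
rewrite !lecE => /andP[/eqP i0 r0] /andP[/eqP i1 r1] Z0 Z1.
rewrite /= in i0 r0 i1 r1.
rewrite ReD ReN !ReM !ImM /= i0 i1 => h.
have g00 : g0 = 0 by apply: complexP; rewrite ?i0//=; move: h r0 r1; lra.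
have g10 : g1 = 0 by apply: complexP; rewrite ?i1//=; move: h r0 r1; lra.
move/negP: v0; apply; apply/eqP/rowP => k; rewrite mxE.
case qk: (n./2 <= k)%N.
  by apply: (Z1 g10); rewrite mem_filter qk eqxx mem_index_enum.
by apply: (Z0 g00); rewrite mem_filter qk eqxx mem_index_enum.
Qed.

End Regularity.

Theorem theorem5p5 (R : realType) (n : nat) (hn0 : (0 < n)%N) (hn : ~~ odd n)
    (p : 'I_n.-1 -> R -> R[i]) (hp : forall k, summable01 (p k))
    (bc : bconds R[i] n) (hbc : normalized bc) (hL : dissipative p bc) :
  birkhoff_regular bc.
Proof. by split; exact: (dissipative_Theta hn0 hn hp hbc hL). Qed.
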